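(* Let $p$ be a positive integer and let $\pi(\kappa)=\kappa^{a-1}(1-\kappa)^{b-1}h(\kappa)$, $\kappa\in(0,1)$, where $a<1$, $0<b<1$, and $h:(0,1]\to(0,\infty)$ is continuously differentiable, slowly varying at $\kappa=0$, and satisfies $\lim_{\kappa\to0}\kappa h'(\kappa)/h(\kappa)=0$. Assume that either $a>-p/2$, or $a=-p/2$ and $\int_0^1\kappa^{-1}h(\kappa)\,\mathrm{d}\kappa<\infty$. Let $H(\kappa)=\kappa h'(\kappa)/h(\kappa)$ for $0<\kappa\le1$ and $H(0)=0$. Suppose $-p/2\le a<p/2-2$. 1. Suppose $H$ is monotone non-increasing on $[0,1]$ with $H(1)\ge-(p/2+a+2)$. Then the (generalized) Bayes estimator of $\beta$ with respect to $\pi(\kappa)$ is minimax under quadratic loss if $$\frac{p+2a+2}{3p/2+a}\le b<1 .$$ 2. Suppose $H$ is monotone non-decreasing on $[0,1]$ with $H(1)<(p/2-a-2)/2$. Then the (generalized) Bayes estimator of $\beta$ with respect to $\pi(\kappa)$ is minimax under quadratic loss if $$\frac{p+2a+2+2H(1)}{3p/2+a}\le b<1 .$$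
   Context: Model: $y\mid\beta\sim N_p(\beta,I_p)$, $\beta\mid\kappa\sim N_p(0,\kappa^{-1}(1-\kappa)I_p)$, $\kappa\sim\pi(\kappa)$ on $(0,1)$, where $\pi(\kappa)$ may be improper. The (generalized) Bayes estimator with respect to $\pi$ is $$\hat\beta(y)=\left(1-\frac{\int_0^1\kappa^{p/2+1}\exp(-\kappa\|y\|^2/2)\pi(\kappa)\,\mathrm{d}\kappa}{\int_0^1\kappa^{p/2}\exp(-\kappa\|y\|^2/2)\pi(\kappa)\,\mathrm{d}\kappa}\right)y .$$ The risk of an estimator $\delta$ is $E_\beta\|\delta(Y)-\beta\|^2$ with $Y\sim N_p(\beta,I_p)$ (quadratic loss). An estimator is minimax if it minimizes the supremum over $\beta\in\mathbb{R}^p$ of the risk among all estimators; the minimax value is $p$, so $\delta$ is minimax if and only if $E_\beta\|\delta(Y)-\beta\|^2\le p$ for all $\beta\in\mathbb{R}^p$. A function $h>0$ is slowly varying at $0$ if $\lim_{\kappa\to0}h(t\kappa)/h(\kappa)=1$ for every $t>0$. *)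

(* Defs.v *)
From HB Require Import structures.
From mathcomp Require Import all_boot all_order all_algebra.
From mathcomp Require Import all_classical all_reals all_analysis.

Set Implicit Arguments.
Unset Strict Implicit.
Unset Printing Implicit Defensive.

Import Order.TTheory GRing.Theory Num.Theory.
Import numFieldNormedType.Exports.

Local Open Scope classical_set_scope.
Local Open Scope ring_scope.

Section euclidean_space.
Context {R : realType}.

(* R^p is [p.-tuple R], with the product Borel sigma-algebra *)
Definition sqnorm p (x : p.-tuple R) : R := \sum_(i < p) tnth x i ^+ 2.

Definition subt p (x y : p.-tuple R) : p.-tuple R :=
  [tuple tnth x i - tnth y i | i < p].

Definition scalet p (c : R) (x : p.-tuple R) : p.-tuple R :=
  [tuple c * tnth x i | i < p].

End euclidean_space.

Section gaussian.
Context {R : realType}.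
Local Notation T := (measurableTypeR R).

Definition tcons p (x : T * p.-tuple T) : p.+1.-tuple T :=
  [the p.+1.-tuple T of x.1 :: x.2].

Lemma measurable_tcons p : measurable_fun [set: T * p.-tuple T] (@tcons p).
Proof. by apply: measurable_cons; [exact: measurable_fst | exact: measurable_snd]. Qed.

HB.instance Definition _ p :=
  isMeasurableFun.Build _ _ (T * p.-tuple T)%type (p.+1.-tuple T) (@tcons p)
    (@measurable_tcons p).

(* N_p(beta, I_p), as the product of the laws N(beta_i, 1) *)
Fixpoint mvnormal p : p.-tuple T -> probability (p.-tuple T) R :=
  match p return p.-tuple T -> probability (p.-tuple T) R with
  | 0 => fun=> dirac [tuple]
  | q.+1 => fun beta =>
      distribution (normal_prob (thead beta) 1 \x mvnormal [tuple of behead beta])%E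
        (@tcons q)
  end.

End gaussian.

Section decision_theory.
Context {R : realType}.
Local Notation T := (measurableTypeR R).
Local Open Scope ereal_scope.

Definition risk p (delta : p.-tuple T -> p.-tuple T) (beta : p.-tuple T) : \bar R :=
  \int[mvnormal beta]_y (sqnorm (subt (delta y) beta))%:E.

Definition estimator p (delta : p.-tuple T -> p.-tuple T) : Prop :=
  measurable_fun [set: p.-tuple T] delta.

Definition minimax p (delta : p.-tuple T -> p.-tuple T) : Prop :=
  estimator delta /\
  forall delta' : p.-tuple T -> p.-tuple T, estimator delta' ->
    ereal_sup (range (risk delta)) <= ereal_sup (range (risk delta')).

End decision_theory.

Section bayes.
Context {R : realType}.
Local Notation mu := (@lebesgue_measure R).

Definition bayes_integral (w : R) (pi : R -> R) (s : R) : R :=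
  (\int[mu]_(k in `]0%R, 1%R[) (k `^ s * expR (- (k * w / 2)) * pi k))%R.

(* generalized Bayes estimator for the (possibly improper) prior density [pi]
   of kappa on (0,1), where beta | kappa ~ N_p(0, (1 - kappa) / kappa I_p) *)
Definition bayes_estimator p (pi : R -> R) (y : p.-tuple R) : p.-tuple R :=
  scalet (1 - bayes_integral (sqnorm y) pi (p%:R / 2 + 1)
              / bayes_integral (sqnorm y) pi (p%:R / 2)) y.

Definition prior (a b : R) (h : R -> R) (k : R) : R :=
  k `^ (a - 1) * (1 - k) `^ (b - 1) * h k.

End bayes.

Section regularity.
Context {R : realType}.

(* Derivatives relative to a subset [D] of the line: two-sided at interior
   points, one-sided at endpoints; values of [f] outside [D] are irrelevant. *)
Definition slope (f : R -> R) (x y : R) : R := (f y - f x) / (y - x).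

Definition derivable_in (D : set R) (f : R -> R) (x : R) : Prop :=
  cvg (slope f x y @[y --> within D x^']).

Definition derive_in (D : set R) (f : R -> R) (x : R) : R :=
  lim (slope f x y @[y --> within D x^']).

Definition continuously_differentiable_in (D : set R) (f : R -> R) : Prop :=
  (forall x, D x -> derivable_in D f x) /\ {within D, continuous (derive_in D f)}.

Definition slowly_varying0 (h : R -> R) : Prop :=
  forall t : R, 0 < t -> h (t * k) / h k @[k --> 0^'+] --> (1 : R).

Definition log_slope (h : R -> R) (k : R) : R :=
  if k == 0 then 0 else k * derive_in `]0, 1] h k / h k.

End regularity.

(* Main.v *)
(* Let c = p/2 + a, v = |y|^2 / 2, and let e_i be the integral of
   k^i u(k) exp(-v k) with u(k) = k^(c-1) (1-k)^(b-1) h(k). The Bayes estimator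
   is (1 - phi(|y|^2)) y with phi = e_1/e_0, and Stein's identity gives
     risk - p = E[w phi^2 - 2 p phi - 4 w phi'],  w = |y|^2,
   whose integrand is 2 phi (2 v e_2/e_1 - v e_1/e_0 - p). So it suffices that
   2 v e_2/e_1 - v e_1/e_0 <= p. With H(k) = k h'(k)/h(k), integrating the
   derivatives of
     k^c (1-k)^b h exp(-v k)  and  k^(c+1) (1-k)^(b-1) h (exp(-v k) - exp(-v))
   relates e_0, e_1, e_2 and integrals of H; in particular
     b v e_2 <= int k (c + 1 + H) (1 - exp(-v (1-k))) u exp(-v k).
   If 0 <= H <= H(1) this is enough; if H is nonincreasing, the integrals of
   H are compared by Chebyshev's association inequality, and c = 0 is
   impossible because h >= h(1) > 0 makes k^-1 h non-integrable at 0.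
   Minimaxity follows since the supremum of any risk is at least p, by
   comparison with the Bayes risks of Gaussian priors of growing variance. *)

Require Import Defs.
From HB Require Import structures.
From mathcomp Require Import all_boot all_order all_algebra.
From mathcomp Require Import all_classical all_reals all_analysis.
From mathcomp Require Import measurable_realfun ring lra.

Set Implicit Arguments.
Unset Strict Implicit.
Unset Printing Implicit Defensive.

Import Order.TTheory GRing.Theory Num.Theory.
Import numFieldNormedType.Exports.

Local Open Scope classical_set_scope.
Local Open Scope ring_scope.

(** * Fundamental theorem of calculus on unbounded or half-open domains *)

(** Why exp(-v) is subtracted in the second product: since b < 1, the factor (1-k)^(b-1) is
    unbounded at 1, and exp(-v k) - exp(-v) vanishes there to first order. Differentiating
    (1-k)^(b-1) leaves (1-b) k^2 (1 - exp(-v (1-k))) / (1-k), which is at most (1-b) v k^2; moved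
    across, this turns v e_2 into b v e_2. The hard case is H <= 0. The first identity then contains
    the loss ez, the integral of (1-k)(-H), with the wrong sign. Convexity of exp gives (1-k)(1 -
    exp(-v)) <= 1 - exp(-v (1-k)), so ez is controlled by the integral of (-H)(1 - exp(-v (1-k))).
    The second inequality controls that integral only with an additional weight k, and Chebyshev's
    inequality removes the weight. The factor 1 - exp(-v) costs little, because the claim is trivial
    unless v > p/2. The lower bound on b in the theorem is 2 (c + 1 + H1) <= b (p + c) in disguise,
    with H1 = 0 in the nonincreasing case and H1 = H(1) in the other. *)

Section exhaustion.
Context {R : realType}.
Local Notation mu := (@lebesgue_measure R).
Variables (U : set R) (f F : R -> R) (x y : nat -> R).
Hypothesis mU : measurable U.
Hypothesis xy : forall n, x n < y n.
Hypothesis xyU : forall n, `[x n, y n] `<=` U.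
Hypothesis exhU : forall t, U t -> \forall n \near \oo, x n <= t <= y n.
Hypothesis dF : forall t, U t -> is_derive t 1 F (f t).
Hypothesis cf : forall t, U t -> {for t, continuous f}.

Let fn n := f \_ `[x n, y n].

Let cfn n : {within `[x n, y n], continuous f}.
Proof.
apply: continuous_in_subspaceT => t /set_mem /xyU; exact: cf.
Qed.

Let intfn n : (\int[mu]_(t in U) (fn n t)%:E = (F (y n) - F (x n))%:E)%E.
Proof.
transitivity (\int[mu]_(t in U) ((EFin \o f) \_ `[x n, y n]) t)%E.
  by rewrite restrict_EFin.
rewrite -integral_mkcondr setIidr; last exact: xyU.
rewrite (@continuous_FTC2 _ f F)//.
- have sub z : z \in `[x n, y n] -> {for z, continuous F}.
    move=> zxy; apply/differentiable_continuous/derivable1_diffP.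
    by have [] := @dF z (@xyU n z zxy).
  split.
  + move=> z zxy; have [] := @dF z _ => //; apply: (@xyU n).
    exact: subset_itv_oo_cc zxy.
  + apply: cvg_at_right_filter; apply: sub.
    by rewrite in_itv/= lexx ltW.
  + apply: cvg_at_left_filter; apply: sub.
    by rewrite in_itv/= lexx ltW.
- move=> z zxy; rewrite derive1E; apply: derive_val.
  apply: dF; apply: (@xyU n).
  exact: subset_itv_oo_cc zxy.
Qed.

Let fnf t : U t -> \forall n \near \oo, fn n t = f t.
Proof.
move=> /exhU; apply: filterS => n xty.
by rewrite /fn patchE mem_set//= in_itv.
Qed.

Let mfn n : measurable_fun U (fn n).
Proof.
apply/(measurable_restrict _ _ mU) => //.
rewrite setIidr; last exact: xyU.
exact: subspace_continuous_measurable_fun.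
Qed.

Let mf : measurable_fun U f.
Proof.
apply: (measurable_fun_cvg (h := fn)) => //.
by move=> t /fnf h; apply: cvg_near_cst.
Qed.

(** The compact-interval theorem applies to f cut off outside [[x n, y n]]; dominated convergence
    with bound |f| removes the cut-off. *)
Lemma cvg_FTC_exhaustion :
  mu.-integrable U (EFin \o f) ->
  F (y n) - F (x n) @[n --> \oo] --> \int[mu]_(t in U) f t.
Proof.
move=> intf.
have [|||||_ _] := @dominated_convergence _ _ _ mu U mU
  (fun n => EFin \o fn n) (EFin \o f) (fun t => `|f t|%:E).
- by move=> n; apply/measurable_EFinP; exact: mfn.
- by apply/measurable_EFinP; exact: mf.
- apply: aeW => t Ut; apply: cvg_near_cst.
  by apply: filterS (@fnf t Ut) => n /= ->.
- by have := integrable_abse intf.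
- apply: aeW => t n Ut; rewrite /fn/= patchE.
  by case: ifPn => //; rewrite ?normr0 lee_fin.
under eq_fun do rewrite intfn.
have /fineK <- : (\int[mu]_(t in U) (EFin \o f) t)%E \is a fin_num.
  exact: integrable_fin_num.
by move=> /fine_cvg.
Qed.

(** Fatou's lemma for the cut-off functions, whose integrals are the increments of F. Every point
    lies in all late intervals, so the lower limit of the cut-offs is f itself. *)
Lemma integrable_FTC_exhaustion (C : R) :
  (forall t, U t -> 0 <= f t) -> (forall n, F (y n) - F (x n) <= C) ->
  mu.-integrable U (EFin \o f).
Proof.
move=> f0 FC; apply/integrableP; split; first by apply/measurable_EFinP; exact: mf.
have -> : (\int[mu]_(t in U) `|(EFin \o f) t| =
    \int[mu]_(t in U) limn_einf (fun n => (fn n t)%:E))%E.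
  apply: eq_integral => t /set_mem Ut; rewrite /= ger0_norm ?f0//.
  apply/esym; rewrite is_cvg_limn_einfE; last first.
    apply/cvg_ex; exists (f t)%:E; apply: cvg_near_cst.
    by apply: filterS (@fnf t Ut) => n /= ->.
  apply/cvg_lim => //; apply: cvg_near_cst.
  by apply: filterS (@fnf t Ut) => n /= ->.
apply: le_lt_trans (fatou _ _ _ _) _ => //.
- by move=> n; apply/measurable_EFinP; exact: mfn.
- move=> n t Ut; rewrite lee_fin /fn patchE; case: ifP => // _; exact: f0.
- under eq_fun do rewrite intfn.
  apply: (@le_lt_trans _ _ C%:E); last exact: ltry.
  apply: (@le_trans _ _ (ereal_sup (range (fun n => (F (y n) - F (x n))%:E)))).
    rewrite limn_einf_lim; apply: lime_le.
      exact: is_cvg_einfs.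
    apply: nearW => n; apply: (@le_trans _ _ (F (y n) - F (x n))%:E).
      by apply: ereal_inf_lbound; exists n => /=.
    by apply: ereal_sup_ubound; exists n.
  by apply: ge_ereal_sup => _ [n _ <-]; rewrite lee_fin.
Qed.
End exhaustion.

Section unit_interval.
Context {R : realType}.
Local Notation mu := (@lebesgue_measure R).
Variables (f F : R -> R).
Hypothesis dF : forall t : R, 0 < t < 1 -> is_derive t (1 : R) F (f t).
Hypothesis cf : forall t : R, 0 < t < 1 -> {for t, continuous f}.

(** The factor 1/3 gives x n < 1/2 < y n already at n = 0. *)
Let x n : R := n.+1%:R^-1 / 3.
Let y n : R := 1 - n.+1%:R^-1 / 3.

Let x_lt n : 0 < x n < 2^-1.
Proof.
have h : 0 < (n.+1%:R^-1 : R) <= 1 by rewrite invr_gt0 ltr0n/= invf_le1// ler1n.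
by rewrite /x; move: (n.+1%:R^-1) h => z; lra.
Qed.

Let x0 : x n @[n --> \oo] --> (0 : R).
Proof.
by rewrite -(mul0r 3^-1); apply: cvgM; [exact: cvg_harmonic|exact: cvg_cst].
Qed.

Let xcvg : x n @[n --> \oo] --> (0 : R)^'+.
Proof.
move=> A /x0; apply: (@filterS _ \oo _ (fun n => 0 < x n -> A (x n))) => n; apply.
by have /andP[] := x_lt n.
Qed.

Let ycvg : y n @[n --> \oo] --> (1 : R)^'-.
Proof.
have y1 : y n @[n --> \oo] --> (1 : R).
  by rewrite -[X in _ --> X]subr0; apply: cvgB; [exact: cvg_cst|exact: x0].
move=> A /y1; apply: (@filterS _ \oo _ (fun n => y n < 1 -> A (y n))) => n; apply.
by rewrite /y -/(x n); have := x_lt n; lra.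
Qed.

Let exh01 (t : R) : `]0, 1[%classic t -> \forall n \near \oo, x n <= t <= y n.
Proof.
move=> /=; rewrite in_itv/= => /andP[t0 t1].
have t1' : 0 < 1 - t by lra.
have h1 : \forall n \near \oo, x n < t by exact: (cvgr_lt (0 : R)).
have h2 : \forall n \near \oo, x n < 1 - t by exact: (cvgr_lt (0 : R)).
apply: filterS2 h1 h2 => n.
rewrite /y -/(x n); lra.
Qed.

Let sub01 n : `[x n, y n] `<=` `]0, 1[.
Proof.
move=> t /=; rewrite !in_itv/= => /andP[xt ty].
have := x_lt n; rewrite /y -/(x n) in ty; lra.
Qed.

Let xy n : x n < y n.
Proof. have := x_lt n; rewrite /y -/(x n); lra. Qed.

Let cvg01 : mu.-integrable `]0, 1[ (EFin \o f) ->
  F (y n) - F (x n) @[n --> \oo] --> \int[mu]_(t in `]0, 1[) f t.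
Proof.
move=> intf; by apply: (@cvg_FTC_exhaustion _ _ f F x y).
Qed.

Lemma FTC01 (l m : R) : mu.-integrable `]0, 1[ (EFin \o f) ->
  F t @[t --> 0^'+] --> l -> F t @[t --> 1^'-] --> m ->
  \int[mu]_(t in `]0, 1[) f t = m - l.
Proof.
move=> /cvg01 intf Fl Fm.
apply: (cvg_unique _ intf) => //.
by apply: cvgB; [exact: cvg_comp ycvg Fm|exact: cvg_comp xcvg Fl].
Qed.

(** Serves the case c = 0, where no limit of the primitive at 0 is at hand: nonnegativity of F near
    0 still gives the upper bound. *)
Lemma FTC01_le (m : R) : mu.-integrable `]0, 1[ (EFin \o f) ->
  (forall t : R, 0 < t < 1 -> 0 <= F t) -> F t @[t --> 1^'-] --> m ->
  \int[mu]_(t in `]0, 1[) f t <= m.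
Proof.
move=> /cvg01 intf F0 Fm.
have Fy : F (y n) @[n --> \oo] --> m by exact: cvg_comp ycvg Fm.
apply: (ler_cvg_to intf Fy); apply: nearW => n.
rewrite gerBl; apply: F0; have := x_lt n; lra.
Qed.

Lemma integrable_FTC01 (C : R) : (forall t : R, 0 < t < 1 -> 0 <= f t) ->
  (forall t : R, 0 < t < 1 -> `|F t| <= C) ->
  mu.-integrable `]0, 1[ (EFin \o f).
Proof.
move=> f0 FC; apply: (@integrable_FTC_exhaustion _ _ f F x y _ _ _ _ _ _ (C + C)) => //.
move=> n; have := x_lt n => xn.
have yn : 0 < y n < 1 by rewrite /y -/(x n); lra.
have xn' : 0 < x n < 1 by lra.
have := FC _ yn; have := FC _ xn'; rewrite !ler_norml; lra.
Qed.
End unit_interval.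

Section real_line.
Context {R : realType}.
Local Notation mu := (@lebesgue_measure R).

Lemma FTC_setT (f F : R -> R) :
  (forall t : R, is_derive t (1 : R) F (f t)) -> continuous f ->
  mu.-integrable setT (EFin \o f) ->
  F t @[t --> +oo] --> (0 : R) -> F t @[t --> -oo] --> (0 : R) ->
  \int[mu]_t f t = 0.
Proof.
move=> dF cf intf Fy FNy.
have yy : (n%:R + 1 : R) @[n --> \oo] --> +oo.
  exact: cvg_comp cvgr_idn (cvg_addrr 1).
have xx : - (n%:R + 1 : R) @[n --> \oo] --> -oo.
  exact/cvgNrNy.
have := @cvg_FTC_exhaustion R setT f F (fun n => - (n%:R + 1)) (fun n => n%:R + 1).
move=> /(_ measurableT) h.
have : F (n%:R + 1) - F (- (n%:R + 1)) @[n --> \oo] --> (0 : R).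
  by rewrite -[X in _ --> X]subr0; apply: cvgB; [exact: cvg_comp yy Fy|exact: cvg_comp xx FNy].
apply: cvg_unique => //; apply: h => //.
- by move=> n; have := ler0n R n; lra.
- move=> t _; exists (Num.bound `|t|) => // n /= tn.
  rewrite -ler_norml; apply: ltW; apply: lt_trans (archi_boundP (normr_ge0 t)) _.
  by rewrite natr1 ltr_nat ltnS.
- by move=> t _; exact: cf.
Qed.
End real_line.

(** * Stein's identity *)

Section density.
Local Open Scope ereal_scope.
Context d (T : measurableType d) (R : realType).
Variables (mu nu : {measure set T -> \bar R}) (g : T -> R).
Hypothesis mg : measurable_fun [set: T] g.
Hypothesis g0 : forall x, (0 <= g x)%R.
Hypothesis nuE : forall A, measurable A -> nu A = \int[mu]_(x in A) (g x)%:E.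

Import HBNNSimple.

Let integral_density_nnsfun (f : {nnsfun T >-> R}) :
  \int[nu]_x (f x)%:E = \int[mu]_x ((f x)%:E * (g x)%:E).
Proof.
under [LHS]eq_integral do rewrite fimfunE -fsumEFin//.
rewrite [LHS]ge0_integral_fsum//; last 2 first.
  - by move=> r; exact/measurable_EFinP/measurableT_comp.
  - by move=> n x _; rewrite EFinM nnfun_muleindic_ge0.
under [RHS]eq_integral.
  move=> x xD; rewrite fimfunE -fsumEFin// ge0_mule_fsuml; last first.
    by move=> r; rewrite EFinM nnfun_muleindic_ge0.
  over.
rewrite [RHS]ge0_integral_fsum//; last 2 first.
  - move=> r; apply: emeasurable_funM; last exact/measurable_EFinP.
    by apply/measurable_EFinP; apply/measurableT_comp.
  - move=> n x _; rewrite mule_ge0 ?lee_fin// -lee_fin EFinM.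
    exact: nnfun_muleindic_ge0.
apply: eq_fsbigr => r _.
rewrite integralZl_indic_nnsfun// integral_indic// setIT nuE//.
have [r0|r0] := leP 0%R r; last first.
  rewrite preimage_nnfun0// integral_set0 mule0.
  by apply/esym/integral0_eq => x _; rewrite indicE in_set0 mulr0 mul0e.
under [RHS]eq_integral do rewrite EFinM -muleA.
rewrite ge0_integralZl//; last 2 first.
  - by apply: emeasurable_funM => //; exact/measurable_EFinP.
  - by move=> x _; rewrite mule_ge0// lee_fin.
congr (_ * _); rewrite integral_mkcond; apply: eq_integral => x _.
by rewrite patchE indicE; case: ifP => _; rewrite ?mul1e ?mul0e.
Qed.

Lemma ge0_integral_density (f : T -> \bar R) :
  measurable_fun [set: T] f -> (forall x, 0 <= f x) ->
  \int[nu]_x f x = \int[mu]_x (f x * (g x)%:E).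
Proof.
move=> mf f0.
pose f_ := nnsfun_approx measurableT mf.
transitivity (lim (\int[nu]_x (f_ n x)%:E @[n --> \oo])).
  rewrite -monotone_convergence//=.
  - apply: eq_integral => ? /[!inE] xD; apply/esym/cvg_lim => //=.
    exact: cvg_nnsfun_approx.
  - by move=> n; exact/measurable_EFinP/measurable_funTS.
  - by move=> n ? _; rewrite lee_fin.
  - by move=> ? _ ? ? mn; rewrite lee_fin; exact/lefP/nd_nnsfun_approx.
transitivity (lim (\int[mu]_x ((f_ n x)%:E * (g x)%:E) @[n --> \oo])).
  by under eq_fun do rewrite integral_density_nnsfun.
rewrite -monotone_convergence//=.
- apply: eq_integral => x /[!inE] xD; apply/cvg_lim => //=.
  apply: cvgeZr => //; exact: cvg_nnsfun_approx.
- move=> n; apply: emeasurable_funM; last exact/measurable_EFinP.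
  exact/measurable_EFinP/measurable_funTS.
- by move=> n x _; rewrite mule_ge0// lee_fin.
- move=> x _ m n mn; apply: lee_wpmul2r; rewrite ?lee_fin//.
  exact/lefP/nd_nnsfun_approx.
Qed.
(** No integrability is required: multiplication by g >= 0 commutes with taking positive and
    negative parts. *)
Lemma integral_density (f : T -> \bar R) : measurable_fun [set: T] f ->
  \int[nu]_x f x = \int[mu]_x (f x * (g x)%:E).
Proof.
move=> mf; rewrite integralE [RHS]integralE.
rewrite (ge0_integral_density (measurable_funepos mf))//.
rewrite (ge0_integral_density (measurable_funeneg mf))//.
congr (_ - _); apply: eq_integral => x _.
- by rewrite !funeposE muleC maxe_pMr ?lee_fin// mule0 muleC.
- by rewrite !funenegE muleC maxe_pMr ?lee_fin// mule0 muleC mulNe.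
Qed.
End density.

Lemma powR_mulB1 {R : realType} (x e : R) : 0 < x -> x * x `^ (e - 1) = x `^ e.
Proof.
move=> x0; rewrite -{1}(powRr1 (ltW x0)) -powRD ?(gt_eqF x0) ?implybT//.
by rewrite addrC subrK.
Qed.

(** * Derivative rules that compose as terms, leaving an algebraic identity for the derivative *)

Section derivative_rules.
Context {R : realType}.
Implicit Types (f g : R -> R) (t a b : R).
Local Notation der t f a := (is_derive t (1 : R) f a).

Lemma drv_cst t a : der t (fun=> a) 0.
Proof. exact: is_derive_cst. Qed.

Lemma drv_add t f g a b : der t f a -> der t g b ->
  der t (fun x => f x + g x) (a + b).
Proof. by move=> fa gb; exact: is_deriveD. Qed.

Lemma drv_opp t f a : der t f a -> der t (fun x => - f x) (- a).
Proof. by move=> fa; exact: is_deriveN. Qed.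

Lemma drv_mul t f g a b : der t f a -> der t g b ->
  der t (fun x => f x * g x) (a * g t + f t * b).
Proof.
by move=> fa gb; apply: is_derive_eq; rewrite /GRing.scale/= addrC (mulrC a).
Qed.

Lemma drv_comp t f g a b : der (g t) f a -> der t g b ->
  der t (fun x => f (g x)) (b * a).
Proof. by move=> fa gb; apply: is_derive_eq (is_derive1_comp fa gb) _; rewrite mulrC. Qed.

Lemma drv_expR t f a : der t f a -> der t (fun x => expR (f x)) (a * expR (f t)).
Proof. by move=> fa; exact: (@drv_comp t expR f). Qed.

Lemma drv_powR t f a (c : R) : 0 < f t -> der t f a ->
  der t (fun x => f x `^ c) (a * (c * f t `^ (c - 1))).
Proof. by move=> f0 fa; apply: (@drv_comp t (fun x => x `^ c) f) => //; exact: is_derive1_powR. Qed.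

Lemma drv_inv t f a : f t != 0 -> der t f a ->
  der t (fun x => (f x)^-1) (- a / f t ^+ 2).
Proof.
move=> f0 fa; have := is_deriveV f0 fa.
by move/is_derive_eq; apply; rewrite /GRing.scale/= mulNr mulrC mulNr.
Qed.

Lemma drv_continuous t f a : der t f a -> {for t, continuous f}.
Proof. by case=> /derivable1_diffP fa _; exact: differentiable_continuous. Qed.
End derivative_rules.

(** * Gaussian integrals and Stein's identity on the line *)

Section normal1.
Context {R : realType}.
Local Notation mu := (@lebesgue_measure R).
Variables (m s : R).
Hypothesis s0 : s != 0.

Lemma ge0_integral_normal_prob (f : R -> \bar R) :
  measurable_fun [set: R] f -> (forall x, (0 <= f x)%E) ->
  (\int[normal_prob m s]_x f x = \int[mu]_x (f x * (normal_pdf m s x)%:E))%E.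
Proof.
move=> mf f0; apply: ge0_integral_density => //.
- exact: measurable_normal_pdf.
- by move=> x; exact: normal_pdf_ge0.
Qed.

Lemma is_derive_normal_pdf (t : R) :
  is_derive t (1 : R) (normal_pdf m s) (- (t - m) / s ^+ 2 * normal_pdf m s t).
Proof.
rewrite normal_pdfE// /normal_fun.
have s2 : s ^+ 2 != 0 by rewrite expf_neq0.
have dX : is_derive t (1 : R) (fun t => t - m) 1.
  by apply: (is_derive_eq (drv_add (is_derive_id t 1) (drv_cst t (- m)))); rewrite addr0.
apply: (is_derive_eq (drv_mul (drv_cst t _) (drv_expR
  (drv_mul (drv_opp (drv_mul dX dX)) (drv_cst t _))))).
by rewrite /=; field.
Qed.

(** Polynomial growth is absorbed by doubling the standard deviation. With v = u^2/(2 s^2), exp(-v)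
    splits as exp(-3v/4) exp(-v/4): the first factor beats u^2, and the second is the Gaussian
    kernel of deviation 2s. Integrability and boundedness of the left side both follow. *)
Lemma normal_pdf_sqr_le : exists2 K, 0 <= K & forall t,
  (1 + `|t - m|) ^+ 2 * normal_pdf m s t <=
  2 * normal_pdf m s t + K * normal_pdf m (2 * s) t.
Proof.
have s2 : 2 * s != 0 by rewrite mulf_neq0// pnatr_eq0.
have p1 := normal_peak_gt0 s0; have p2 := normal_peak_gt0 s2.
have sp : 0 <= 8 / 3 * s ^+ 2 by have := sqr_ge0 s; lra.
(* From u^2 = (8/3) s^2 (3v/4) and x exp(-x) <= 1 at x = 3v/4; the ratio of peaks exchanges the
   normalizing constants. *)
exists (2 * (8 / 3 * s ^+ 2) * (normal_peak s / normal_peak (2 * s))).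
  by apply: mulr_ge0; [exact: mulr_ge0|apply: divr_ge0; exact: ltW].
move=> t; rewrite !normal_pdfE// /normal_fun.
set u := t - m; set v := u ^+ 2 / (s ^+ 2 *+ 2).
have s2p : 0 < s ^+ 2 by rewrite exprn_even_gt0.
have -> : - u ^+ 2 / (s ^+ 2 *+ 2) = - (3 / 4 * v) + - (v / 4).
  by rewrite /v; field.
have -> : - u ^+ 2 / ((2 * s) ^+ 2 *+ 2) = - (v / 4) by rewrite /v; field.
have u2 : u ^+ 2 = 8 / 3 * s ^+ 2 * (3 / 4 * v) by rewrite /v; field.
have v0 : 0 <= v by rewrite /v divr_ge0 ?sqr_ge0// mulrn_wge0// ltW.
rewrite expRD; set a := expR (- (3 / 4 * v)); set b := expR (- (v / 4)).
have a0 : 0 < a by exact: expR_gt0.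
have b0 : 0 < b by exact: expR_gt0.
have va : (3 / 4 * v) * a <= 1.
  rewrite /a expRN ler_pdivrMr ?expR_gt0// mul1r.
  by apply: le_trans (expR_ge1Dx _); lra.
have h : (1 + `|u|) ^+ 2 <= 2 + 2 * u ^+ 2.
  rewrite -(real_normK (num_real u)); have := sqr_ge0 (1 - `|u|); nra.
apply: (@le_trans _ _ ((2 + 2 * u ^+ 2) * (normal_peak s * (a * b)))).
  by apply: ler_wpM2r => //; rewrite !mulr_ge0// ltW.
rewrite mulrDl lerD2l {1}u2.
have -> : 2 * (8 / 3 * s ^+ 2 * (3 / 4 * v)) * (normal_peak s * (a * b)) =
  (2 * (8 / 3 * s ^+ 2) * normal_peak s * b) * (3 / 4 * v * a) by ring.
have -> : 2 * (8 / 3 * s ^+ 2) * (normal_peak s / normal_peak (2 * s)) *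
  (normal_peak (2 * s) * b) = 2 * (8 / 3 * s ^+ 2) * normal_peak s * b.
  by field; rewrite gt_eqF.
apply: ler_piMr => //; apply: mulr_ge0; last exact: ltW.
by apply: mulr_ge0; [exact: mulr_ge0|exact: ltW].
Qed.

Lemma integrable_normal_pdf_sqr :
  mu.-integrable setT (fun t => ((1 + `|t - m|) ^+ 2 * normal_pdf m s t)%:E).
Proof.
have [K K0 hK] := normal_pdf_sqr_le.
apply: (@le_integrable _ _ _ mu setT measurableT _
  (fun t => (2 * normal_pdf m s t + K * normal_pdf m (2 * s) t)%:E)).
- apply/measurable_EFinP; apply: measurable_funM; last exact: measurable_normal_pdf.
  apply: measurable_funX; apply: measurable_funD => //.
  by apply: measurableT_comp => //; exact: measurable_funB.
- move=> t _ /=; rewrite lee_fin; apply: le_trans (ler_norm _).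
  by rewrite ger0_norm ?hK// mulr_ge0 ?normal_pdf_ge0// sqr_ge0.
- under eq_fun do rewrite EFinD !EFinM.
  apply: integrableD => //; apply: integrableZl => //; exact: integrable_normal_pdf.
Qed.

Lemma normal_pdf_sqr_bounded : exists K, forall t,
  (1 + `|t - m|) ^+ 2 * normal_pdf m s t <= K.
Proof.
have [K K0 hK] := normal_pdf_sqr_le.
have s2 : 2 * s != 0 by rewrite mulf_neq0// pnatr_eq0.
exists (2 * normal_peak s + K * normal_peak (2 * s)) => t.
apply: (le_trans (hK t)); apply: lerD.
  by rewrite ler_pM2l//; exact: normal_pdf_ub.
by apply: ler_wpM2l => //; exact: normal_pdf_ub.
Qed.

Section stein1.
Variables (g g' : R -> R) (C : R).
Hypothesis dg : forall t : R, is_derive t (1 : R) g (g' t).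
Hypothesis cg' : continuous g'.
Hypothesis g_le : forall t, `|g t| <= C * (1 + `|t - m|).
Hypothesis g'_le : forall t, `|g' t| <= C.

Let mg : measurable_fun [set: R] g.
Proof. by apply: continuous_measurable_fun => t; exact: drv_continuous (dg t). Qed.

Let mg' : measurable_fun [set: R] g'.
Proof. exact: continuous_measurable_fun. Qed.

Let C0 : 0 <= C. Proof. exact: le_trans (normr_ge0 _) (g'_le 0). Qed.

Lemma integrable_stein_lhs :
  mu.-integrable setT (fun t => ((t - m) * g t * normal_pdf m s t)%:E).
Proof.
apply: (@le_integrable _ _ _ mu setT measurableT _
  (fun t => (C * ((1 + `|t - m|) ^+ 2 * normal_pdf m s t))%:E)).
- apply/measurable_EFinP; apply: measurable_funM; last exact: measurable_normal_pdf.
  by apply: measurable_funM => //; exact: measurable_funB.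
- move=> t _ /=; rewrite lee_fin; apply: le_trans (ler_norm _).
  rewrite !normrM (ger0_norm (normal_pdf_ge0 _ _ _)) [leRHS]mulrA.
  apply: ler_wpM2r; first exact: normal_pdf_ge0.
  have := g_le t; have := normr_ge0 (g t); have := normr_ge0 (t - m).
  move: (`|t - m|) (`|g t|) => u v u0 v0 vle.
  apply: (@le_trans _ _ (u * (C * (1 + u)))); first exact: ler_wpM2l.
  have := mulr_ge0 C0 u0; nra.
- by under eq_fun do rewrite EFinM; apply: integrableZl => //; exact: integrable_normal_pdf_sqr.
Qed.

Lemma integrable_stein_rhs :
  mu.-integrable setT (fun t => (g' t * normal_pdf m s t)%:E).
Proof.
apply: (@le_integrable _ _ _ mu setT measurableT _
  (fun t => (C * normal_pdf m s t)%:E)).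
- by apply/measurable_EFinP; apply: measurable_funM => //; exact: measurable_normal_pdf.
- move=> t _ /=; rewrite lee_fin !normrM (ger0_norm C0).
  rewrite (ger0_norm (normal_pdf_ge0 _ _ _)).
  by apply: ler_wpM2r; first exact: normal_pdf_ge0.
- by under eq_fun do rewrite EFinM; apply: integrableZl => //; exact: integrable_normal_pdf.
Qed.

(** One argument for both infinities: g grows at most linearly and (1 + |t-m|)^2 times the density
    is bounded, so the product is O(1/(1 + |t-m|)). *)
Let cvg0 : forall F : set_system R, ProperFilter F ->
  (`|t - m| @[t --> F] --> +oo) ->
  s ^+ 2 * (g t * normal_pdf m s t) @[t --> F] --> (0 : R).
Proof.
move=> F PF hF.
have [K hK] := normal_pdf_sqr_bounded.
have K0 : 0 <= K.
  by apply: le_trans (hK 0); rewrite mulr_ge0 ?sqr_ge0// normal_pdf_ge0.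
rewrite -[X in _ --> X](mulr0 (s ^+ 2)); apply: cvgM; first exact: cvg_cst.
apply/norm_cvg0P.
apply: (@squeeze_cvgr _ _ _ _ (fun=> 0) (fun t => C * K * (1 + `|t - m|)^-1)).
- apply: nearW => t; rewrite normr_ge0/= normrM (ger0_norm (normal_pdf_ge0 _ _ _)).
  have u0 : 0 < 1 + `|t - m| by rewrite ltr_pwDl.
  rewrite ler_pdivlMr//.
  apply: (@le_trans _ _ (C * ((1 + `|t - m|) ^+ 2 * normal_pdf m s t))).
    rewrite expr2 mulrAC !mulrA; apply: ler_wpM2r; first exact: normal_pdf_ge0.
    by apply: ler_wpM2r => //; exact: ltW.
  by apply: ler_wpM2l.
- exact: cvg_cst.
- rewrite -[X in _ --> X](mulr0 (C * K)); apply: cvgM; first exact: cvg_cst.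
  apply/gtr0_cvgV0.
    by apply: nearW => t; rewrite ltr_pwDl.
  exact: cvg_comp hF (cvg_addrl 1).
Qed.

(** The difference of the two integrands is the derivative of s^2 g times the density, which
    vanishes at both infinities. *)
Lemma stein_normal_pdf : (\int[mu]_t ((t - m) * g t * normal_pdf m s t) =
  s ^+ 2 * \int[mu]_t (g' t * normal_pdf m s t))%R.
Proof.
rewrite -RintegralZl//; last exact: integrable_stein_rhs.
apply/esym/eqP; rewrite -subr_eq0 -RintegralB//; last 2 first.
- exact: (integrableZl measurableT (s ^+ 2) integrable_stein_rhs).
- exact: integrable_stein_lhs.
apply/eqP; apply: (@FTC_setT _ (fun t => s ^+ 2 * (g' t * normal_pdf m s t) -
  (t - m) * g t * normal_pdf m s t) (fun t => s ^+ 2 * (g t * normal_pdf m s t))).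
- move=> t; apply: (is_derive_eq (drv_mul (drv_cst t _)
    (drv_mul (dg t) (is_derive_normal_pdf t)))).
  by rewrite /=; field.
- move=> t; have cn := @continuous_normal_pdf R m s s0 t.
  apply: cvgB; apply: cvgM.
  + exact: cvg_cst.
  + by apply: cvgM => //; exact: cg'.
  + apply: cvgM; last exact: drv_continuous (dg t).
    by apply: cvgB; [exact: cvg_id|exact: cvg_cst].
  + exact: cn.
- exact: (integrableB measurableT
    (integrableZl measurableT (s ^+ 2) integrable_stein_rhs) integrable_stein_lhs).
- apply: cvg0; apply/cvgryPge => A; near=> t.
  apply: le_trans (ler_norm _); rewrite lerBrDr; near: t.
  by apply: nbhs_pinfty_ge; exact: num_real.
- apply: cvg0; apply/cvgryPge => A; near=> t.
  rewrite distrC; apply: le_trans (ler_norm _); rewrite lerBrDl -lerBrDr; near: t.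
  by apply: nbhs_ninfty_le; exact: num_real.
Unshelve. all: by end_near. Qed.
End stein1.

Lemma integral_normal_prob (f : R -> R) : measurable_fun [set: R] f ->
  (\int[normal_prob m s]_x (f x)%:E = \int[mu]_x (f x * normal_pdf m s x)%:E)%E.
Proof.
move=> mf; rewrite (@integral_density _ _ _ mu _ (normal_pdf m s))//.
- exact: measurable_normal_pdf.
- by move=> x; rewrite normal_pdf_ge0.
- exact/measurable_EFinP.
Qed.

Lemma stein_normal_prob (g g' : R -> R) (C : R) :
  (forall t : R, is_derive t (1 : R) g (g' t)) -> continuous g' ->
  (forall t, `|g t| <= C * (1 + `|t - m|)) -> (forall t, `|g' t| <= C) ->
  (\int[normal_prob m s]_t ((t - m) * g t)%:E =
   (s ^+ 2)%:E * \int[normal_prob m s]_t (g' t)%:E)%E.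
Proof.
move=> dg cg' gC g'C.
have mg : measurable_fun [set: R] g.
  by apply: continuous_measurable_fun => t; exact: drv_continuous (dg t).
have mg' : measurable_fun [set: R] g' by exact: continuous_measurable_fun.
rewrite !integral_normal_prob//; last first.
  by apply: measurable_funM => //; exact: measurable_funB.
have i1 := integrable_stein_lhs dg gC g'C.
have i2 := integrable_stein_rhs cg' g'C.
rewrite -(fineK (integrable_fin_num measurableT i1)).
rewrite -[in RHS](fineK (integrable_fin_num measurableT i2)) -EFinM.
by congr EFin; exact: (stein_normal_pdf dg cg' gC g'C).
Qed.

Lemma normal_second_moment (d : R) :
  (\int[normal_prob m s]_t ((d - t) ^+ 2)%:E = (s ^+ 2 + (d - m) ^+ 2)%:E)%E.
Proof.
rewrite integral_normal_prob; last by apply: measurable_funX; exact: measurable_funB.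
(* Chosen so that (t - m) g(t) + (d - m)^2 = (d - t)^2; as g' = 1, Stein's identity evaluates the
   first term. *)
pose g (t : R) := t - m - 2 * (d - m).
have dg (t : R) : is_derive t (1 : R) g ((fun=> 1) t).
  apply: (is_derive_eq (drv_add (drv_add (is_derive_id t 1) (drv_cst t (- m)))
    (drv_cst t (- (2 * (d - m)))))).
  by rewrite !addr0.
pose C := 1 + 2 * `|d - m|.
have C1 : 1 <= C by rewrite /C lerDl mulr_ge0.
have gC t : `|g t| <= C * (1 + `|t - m|).
  apply: le_trans (ler_normB _ _) _; rewrite normrM (ger0_norm (_ : 0 <= 2))//.
  rewrite /C; have := normr_ge0 (d - m); have := normr_ge0 (t - m); nra.
have g'C (t : R) : `|1 : R| <= C by rewrite normr1.
have cg' : continuous ((fun=> 1) : R -> R) by exact: cst_continuous.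
have i1 := integrable_stein_lhs dg gC g'C.
have i2 := integrable_stein_rhs cg' g'C.
have := stein_normal_pdf dg cg' gC g'C.
have -> : \int[mu]_t (1 * normal_pdf m s t) = 1.
  under eq_Rintegral do rewrite mul1r.
  by rewrite /Rintegral integral_normal_pdf.
rewrite mulr1 => h.
transitivity (\int[mu]_t ((t - m) * g t * normal_pdf m s t)%:E +
   \int[mu]_t ((d - m) ^+ 2 * normal_pdf m s t)%:E)%E.
  rewrite -integralD//; last exact: (integrableZl measurableT _ (integrable_normal_pdf m s)).
  by apply: eq_integral => t _; rewrite -EFinD /g; congr EFin; ring.
rewrite -(fineK (integrable_fin_num measurableT i1)) [X in (X%:E + _)%E]h EFinD; congr (_ + _)%E.
under eq_integral do rewrite EFinM.
rewrite integralZl//; last exact: integrable_normal_pdf.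
by rewrite integral_normal_pdf mule1.
Qed.
End normal1.

(** * The multivariate normal law *)

Section mvnormal_recursion.
Context {R : realType}.
Local Notation T := (measurableTypeR R).

Lemma tnth_tcons0 q (z : T * q.-tuple T) : tnth (tcons z) ord0 = z.1.
Proof. by []. Qed.

Lemma measurable_tcons_pair q (x : T) :
  measurable_fun [set: q.-tuple T] (fun y => tcons (x, y)).
Proof. by apply: measurable_cons; [exact: measurable_cst|exact: measurable_id]. Qed.

Lemma tnth_tconsS q (z : T * q.-tuple T) i : tnth (tcons z) (lift ord0 i) = tnth z.2 i.
Proof. by rewrite /tcons tnthS. Qed.

Lemma tnth_thead q (b : q.+1.-tuple T) : tnth b ord0 = thead b.
Proof. by []. Qed.

Lemma tnth_behead q (b : q.+1.-tuple T) i : tnth b (lift ord0 i) = tnth [tuple of behead b] i.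
Proof. by rewrite [in LHS](tuple_eta b) tnthS. Qed.

Local Open Scope ereal_scope.

Local Notation prodmeas b :=
  (normal_prob (thead b) 1 \x mvnormal [tuple of behead b]).

Lemma ge0_integral_mvnormalS q (b : q.+1.-tuple T) (f : q.+1.-tuple T -> \bar R) :
  measurable_fun [set: q.+1.-tuple T] f -> (forall y, 0 <= f y) ->
  \int[mvnormal b]_y f y =
  \int[normal_prob (thead b) 1]_x \int[mvnormal [tuple of behead b]]_y f (tcons (x, y)).
Proof.
move=> mf f0.
have mt := @measurable_tcons R q.
have mft : measurable_fun setT (f \o @tcons R q) by exact: measurableT_comp.
transitivity (\int[prodmeas b]_z (f \o @tcons R q) z).
  rewrite -[RHS](@ge0_integral_pushforward _ _ _ _ _ _ mt _ setT)//.
by rewrite fubini_tonelli1// => z; exact: f0.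
Qed.

Lemma integrable_mvnormalS q (b : q.+1.-tuple T) (f : q.+1.-tuple T -> \bar R) :
  (mvnormal b).-integrable [set: q.+1.-tuple T] f ->
  (prodmeas b).-integrable [set: T * q.-tuple T] (f \o @tcons R q).
Proof.
move=> /integrableP[mf fy]; have mt := @measurable_tcons R q.
apply/integrableP; split; first exact: measurableT_comp.
rewrite ge0_integral_mvnormalS// in fy; last exact: measurableT_comp.
rewrite fubini_tonelli1//; apply: measurableT_comp => //.
exact: measurableT_comp.
Qed.

Lemma integral_mvnormalS q (b : q.+1.-tuple T) (f : q.+1.-tuple T -> \bar R) :
  (mvnormal b).-integrable [set: q.+1.-tuple T] f ->
  \int[mvnormal b]_y f y =
  \int[normal_prob (thead b) 1]_x \int[mvnormal [tuple of behead b]]_y f (tcons (x, y)).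
Proof.
move=> intf; have mf := measurable_int _ intf.
have mt := @measurable_tcons R q.
have intft := integrable_mvnormalS intf.
transitivity (\int[prodmeas b]_z (f \o @tcons R q) z).
  by rewrite -[RHS](@integral_pushforward _ _ _ _ _ _ mt _ setT)//.
by rewrite -integral12_prod_meas1.
Qed.

Lemma measurable_coord p (i : 'I_p) (k : R -> R) : measurable_fun [set: R] k ->
  measurable_fun [set: p.-tuple T] (fun y => k (tnth y i)).
Proof. by move=> mk; apply: (measurableT_comp mk); exact: measurable_tnth. Qed.

Lemma integral_mvnormal_prod p (b : p.-tuple T) (k : 'I_p -> R -> R) (c : 'I_p -> R) :
  (forall i, measurable_fun [set: R] (k i)) -> (forall i t, (0 <= k i t)%R) ->
  (forall i, \int[normal_prob (tnth b i) 1]_t (k i t)%:E = (c i)%:E) ->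
  \int[mvnormal b]_y (\prod_(i < p) k i (tnth y i))%:E = (\prod_(i < p) c i)%:E.
Proof.
elim: p => [|q IH] in b k c *.
  move=> _ _ _; rewrite big_ord0.
  under eq_integral do rewrite big_ord0.
  by rewrite integral_cst// mul1e; exact: probability_setT.
move=> mk k0 kc; rewrite ge0_integral_mvnormalS; last 2 first.
- apply/measurable_EFinP; apply: measurable_prod => i _.
  exact: measurable_coord.
- by move=> y; rewrite lee_fin prodr_ge0.
transitivity (\int[normal_prob (thead b) 1]_x ((k ord0 x)%:E * (\prod_(i < q) c (lift ord0 i))%:E)).
  apply: eq_integral => x _.
  under eq_integral.
    move=> y _; rewrite big_ord_recl tnth_tcons0 EFinM.
    under eq_bigr do rewrite tnth_tconsS.
    over.
  rewrite /= ge0_integralZl//; last 3 first.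
  - apply/measurable_EFinP; apply: measurable_prod => i _.
    exact: measurable_coord.
  - by move=> y _; rewrite lee_fin prodr_ge0.
  - by rewrite lee_fin.
  congr (_ * _); apply: (IH _ (fun i => k (lift ord0 i))) => // i.
  by rewrite -tnth_behead.
have c0 i : (0 <= c i)%R.
  by rewrite -lee_fin -kc integral_ge0// => x _; rewrite lee_fin.
rewrite ge0_integralZr//; last 3 first.
- by apply/measurable_EFinP; exact: mk.
- by move=> x _; rewrite lee_fin.
- by rewrite lee_fin prodr_ge0.
by rewrite -tnth_thead kc -EFinM big_ord_recl.
Qed.

Lemma integral_mvnormal_coord p (b : p.-tuple T) i (k : R -> R) (c : R) :
  measurable_fun [set: R] k -> (forall t, (0 <= k t)%R) ->
  \int[normal_prob (tnth b i) 1]_t (k t)%:E = c%:E ->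
  \int[mvnormal b]_y (k (tnth y i))%:E = c%:E.
Proof.
move=> mk k0 kc.
(* A function of one coordinate is a product whose other factors are 1. *)
have -> : c = (\prod_(j < p) (if j == i then c else 1))%R.
  by rewrite -big_mkcond/= big_pred1_eq.
rewrite -(@integral_mvnormal_prod p b (fun (j : 'I_p) (t : R) => if j == i then k t else 1%R)).
- apply: eq_integral => y _; congr EFin.
  by rewrite -big_mkcond/= big_pred1_eq.
- by move=> j; case: (j == i); [exact: mk|exact: measurable_cst].
- by move=> j t; case: (j == i).
- move=> j; case: eqVneq => [->//|_].
  by rewrite integral_cst// mul1e; exact: probability_setT.
Qed.

(** Partial derivatives in coordinate i are ordinary derivatives of [t |-> upd y i t]. *)
Definition upd p (y : p.-tuple T) (i : 'I_p) (t : T) : p.-tuple T :=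
  [tuple if j == i then t else tnth y j | j < p].

Lemma upd_tcons0 q (x t : T) (y : q.-tuple T) : upd (tcons (x, y)) ord0 t = tcons (t, y).
Proof.
apply: eq_from_tnth => j; rewrite tnth_mktuple.
case: (unliftP ord0 j) => [k ->|->]; last by rewrite eqxx.
by rewrite eq_sym (negbTE (neq_lift _ _)) !tnth_tconsS.
Qed.

Lemma upd_tconsS q (x t : T) (y : q.-tuple T) i :
  upd (tcons (x, y)) (lift ord0 i) t = tcons (x, upd y i t).
Proof.
apply: eq_from_tnth => j; rewrite tnth_mktuple.
case: (unliftP ord0 j) => [k ->|->]; last by rewrite (negbTE (neq_lift _ _)).
by rewrite !tnth_tconsS/= tnth_mktuple (inj_eq lift_inj).
Qed.

(** Quadratic growth in a single coordinate is dominated by a one-dimensional Gaussian moment; this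
    is the source of the integrability claims for the risk. *)
Lemma integrable_mvnormal_sqr p (b : p.-tuple T) i (C : R) (f : p.-tuple T -> R) :
  measurable_fun [set: p.-tuple T] f ->
  (forall y, `|f y| <= C * (1 + `|tnth y i - tnth b i|) ^+ 2)%R ->
  (mvnormal b).-integrable [set: p.-tuple T] (EFin \o f).
Proof.
move=> mf fC; apply: (@le_integrable _ _ _ (mvnormal b) setT measurableT (EFin \o f)
  (fun y => C%:E * ((1 + `|tnth y i - tnth b i|) ^+ 2)%R%:E)).
- exact/measurable_EFinP.
- by move=> y _; rewrite /= lee_fin; apply: le_trans (fC y) (ler_norm _).
apply: integrableZl => //.
have mk : measurable_fun [set: R] (fun t : R => (1 + `|t - tnth b i|) ^+ 2)%R.
  apply: measurable_funX; apply: measurable_funD => //.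
  by apply: measurableT_comp => //; exact: measurable_funB.
apply/integrableP; split.
  by apply/measurable_EFinP; exact: (measurable_coord _ mk).
under eq_integral do rewrite /= ger0_norm ?sqr_ge0//.
have h := integrable_normal_pdf_sqr (tnth b i) (oner_neq0 R).
pose c := fine (\int[normal_prob (tnth b i) 1]_t ((1 + `|t - tnth b i|) ^+ 2)%:E).
rewrite (@integral_mvnormal_coord _ _ i (fun t : R => (1 + `|t - tnth b i|) ^+ 2)%R c) ?ltry//.
rewrite /c fineK// integral_normal_prob//; exact: integrable_fin_num h.
Qed.

(** Induction on the dimension: for a coordinate other than the first, the induction hypothesis
    applies on each slice with fixed first coordinate; for the first one, the one-dimensional
    identity does. *)
Lemma stein_mvnormal p (b : p.-tuple T) (i : 'I_p) (G G' : p.-tuple T -> R) (C : R) :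
  measurable_fun [set: p.-tuple T] G -> measurable_fun [set: p.-tuple T] G' ->
  (forall y, `|G y| <= C * (1 + `|tnth y i - tnth b i|))%R ->
  (forall y, `|G' y| <= C)%R ->
  (forall y (t : R), is_derive t (1 : R)%R (fun t => G (upd y i t)) (G' (upd y i t))) ->
  (forall y, continuous ((fun t => G' (upd y i t)) : R -> R)) ->
  \int[mvnormal b]_y ((tnth y i - tnth b i) * G y)%:E = \int[mvnormal b]_y (G' y)%:E.
Proof.
elim: p => [|q IH] in b i G G' *; first by case: i.
move=> mG mG' GC G'C dG cG'.
have C0 : (0 <= C)%R by exact: le_trans (normr_ge0 _) (G'C b).
have i1 : (mvnormal b).-integrable setT (EFin \o (fun y => (tnth y i - tnth b i) * G y)%R).
  apply: (@integrable_mvnormal_sqr _ _ i C).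
    apply: measurable_funM => //; apply: measurable_funB => //.
    exact: measurable_tnth.
  move=> y; rewrite normrM; have := GC y; have := normr_ge0 (G y).
  have := normr_ge0 (tnth y i - tnth b i)%R.
  move: (`|tnth y i - tnth b i|)%R (`|G y|)%R => u v u0 v0 vle.
  apply: (@le_trans _ _ (u * (C * (1 + u)))%R); first exact: ler_wpM2l.
  by have := mulr_ge0 C0 u0; nra.
have i2 : (mvnormal b).-integrable setT (EFin \o G').
  apply: (@integrable_mvnormal_sqr _ _ i C) => // y.
  apply: (le_trans (G'C y)); rewrite ler_peMr// expr_ge1//.
  by rewrite lerDl.
rewrite (integral_mvnormalS i1) (integral_mvnormalS i2) /=.
case: (unliftP ord0 i) => [j ij|i0]; subst i.
- apply: eq_integral => x _.
  apply: etrans (IH [tuple of behead b] j (fun y => G (tcons (x, y)))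
    (fun y => G' (tcons (x, y))) _ _ _ _ _ _).
  + by apply: eq_integral => y _; rewrite tnth_tconsS tnth_behead.
  + apply: measurableT_comp => //.
    exact: measurable_tcons_pair.
  + apply: measurableT_comp => //.
    exact: measurable_tcons_pair.
  + by move=> y; have := GC (tcons (x, y)); rewrite tnth_tconsS tnth_behead.
  + by move=> y; exact: G'C.
  + by move=> y t; have := dG (tcons (x, y)) t; under eq_fun do rewrite upd_tconsS; rewrite upd_tconsS.
  + by move=> y; have := cG' (tcons (x, y)); under eq_fun do rewrite upd_tconsS.
(* Fubini makes the first coordinate the inner variable. *)
- have := integrable_mvnormalS i1; have := integrable_mvnormalS i2.
  move=> /Fubini/= -> /Fubini/= ->; apply: eq_integral => y _.
  have -> : \int[normal_prob (thead b) 1]_x (G' (tcons (x, y)))%:E =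
      (1 ^+ 2)%R%:E * \int[normal_prob (thead b) 1]_x (G' (tcons (x, y)))%:E.
    by rewrite expr1n mul1e.
  apply: (@stein_normal_prob R (thead b) 1 (oner_neq0 R) (fun x => G (tcons (x, y)))
    (fun x => G' (tcons (x, y))) C).
  + by move=> t; have := dG (tcons (0%R, y)) t; under eq_fun do rewrite upd_tcons0; rewrite upd_tcons0.
  + by have := cG' (tcons (0%R, y)); under eq_fun do rewrite upd_tcons0.
  + by move=> t; have := GC (tcons (t, y)); rewrite tnth_tcons0.
  + by move=> t; exact: G'C.
Qed.

(** Likelihood ratio of N_p(b, I_p) to N_p(0, I_p). *)
Let wgt p (b y : p.-tuple T) : R :=
  (\prod_(i < p) expR (tnth b i * tnth y i - tnth b i ^+ 2 / 2))%R.

(** The zero mean is any tuple z with zero coordinates, so that the induction can pass to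
    [behead z]. *)
Lemma mvnormal_density p (b z : p.-tuple T) (f : p.-tuple T -> \bar R) :
  (forall i, tnth z i = 0%R) ->
  measurable_fun [set: p.-tuple T] f -> (forall y, 0 <= f y) ->
  \int[mvnormal b]_y f y = \int[mvnormal z]_y
    (f y * (\prod_(i < p) expR (tnth b i * tnth y i - tnth b i ^+ 2 / 2))%:E).
Proof.
have mw (c : R) : measurable_fun [set: R] (fun t : R => expR (c * t - c ^+ 2 / 2)).
  apply: measurableT_comp => //; apply: measurable_funB; last exact: measurable_cst.
  by apply: measurable_funM; [exact: measurable_cst|exact: measurable_id].
have mW r (c : r.-tuple T) : measurable_fun [set: r.-tuple T] (fun y => (wgt c y)%:E).
  by apply/measurable_EFinP; apply: measurable_prod => i _; exact: (measurable_coord _ (mw _)).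
have W0 r (c y : r.-tuple T) : 0 <= (wgt c y)%:E.
  by rewrite lee_fin prodr_ge0// => i _; exact: expR_ge0.
elim: p => [|q IH] in b z f *.
  move=> _ mf f0; rewrite (tuple0 b) (tuple0 z).
  by apply: eq_integral => y _; rewrite big_ord0 mule1.
move=> z0 mf f0.
have z1 : thead z = 0%R by exact: z0.
have z2 i : tnth [tuple of behead z] i = 0%R by rewrite -tnth_behead.
pose g y := f y * (wgt b y)%:E.
have mg : measurable_fun [set: q.+1.-tuple T] g by apply: emeasurable_funM; [exact: mf|exact: mW].
have g0 y : 0 <= g y by apply: mule_ge0; [exact: f0|exact: W0].
apply: (etrans (ge0_integral_mvnormalS b mf f0)).
apply/esym; apply: (etrans (ge0_integral_mvnormalS z mg g0)); apply/esym.
rewrite z1.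
have mfx (x : T) : measurable_fun [set: q.-tuple T] (fun y => f (tcons (x, y))).
  exact: (measurableT_comp mf (measurable_tcons_pair x)).
pose h (x : T) := \int[mvnormal [tuple of behead b]]_y f (tcons (x, y)).
have mh : measurable_fun [set: R] h.
  apply: (@measurable_fun_fubini_tonelli_F _ _ _ _ R (mvnormal [tuple of behead b]) (f \o @tcons R q)).
  - by apply: measurableT_comp => //; exact: measurable_tcons.
  - by move=> ?; exact: f0.
have h0 (x : R) : 0 <= h x by apply: integral_ge0 => y _; exact: f0.
transitivity (\int[normal_prob 0 1]_x
    ((expR (thead b * x - thead b ^+ 2 / 2))%:E * h x)); last first.
  apply: eq_integral => x _.
  rewrite /h (IH _ [tuple of behead z])//.
  rewrite -ge0_integralZl//; first last.
  - by move=> y _; apply: mule_ge0; [exact: f0|exact: W0].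
  - by apply: emeasurable_funM; [exact: mfx|exact: mW].
  apply: eq_integral => y _; rewrite /g /wgt big_ord_recl tnth_tcons0 tnth_thead/=.
  under [in RHS]eq_bigr do rewrite tnth_tconsS tnth_behead.
  by rewrite EFinM muleCA.
rewrite (ge0_integral_normal_prob _ _ mh h0).
rewrite ge0_integral_normal_prob; last 2 first.
- by apply: emeasurable_funM => //; apply/measurable_EFinP; exact: mw.
- by move=> x; rewrite mule_ge0// lee_fin expR_ge0.
apply: eq_integral => x _; rewrite muleAC -EFinM muleC; congr (_%:E * _).
rewrite !normal_pdfE ?oner_neq0// /normal_fun mulrCA -expRD.
by congr (_ * expR _)%R; field.
Qed.
End mvnormal_recursion.

(** * Lower bound for the minimax risk *)

Section risk_lower_bound.
Context {R : realType}.
Local Notation T := (measurableTypeR R).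

(** Completing the square: the weight times the N(0,1) density is K times the density of N(y/(1+c),
    1/(1+c)). K does not depend on d, so the mass and every quadratic loss share it. It is used with
    c = e - 1, y = 0 for the prior and with c = e for the joint density. *)
Lemma gaussian_weight (c y : R) : 0 < 1 + c ->
  exists2 K : R, 0 < K & forall d : R,
   (\int[normal_prob 0 1]_t (expR (t * y - c * t ^+ 2 / 2))%:E = K%:E)%E /\
   (\int[normal_prob 0 1]_t ((d - t) ^+ 2 * expR (t * y - c * t ^+ 2 / 2))%:E =
    (K * ((1 + c)^-1 + (d - y / (1 + c)) ^+ 2))%:E)%E.
Proof.
move=> c0; pose s := Num.sqrt (1 + c)^-1.
have s2 : s ^+ 2 = (1 + c)^-1 by rewrite sqr_sqrtr// invr_ge0 ltW.
have s0 : s != 0 by rewrite gt_eqF// sqrtr_gt0 invr_gt0.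
pose m := y * s ^+ 2.
have ps := normal_peak_gt0 s0.
have p1 := normal_peak_gt0 (oner_neq0 R).
pose K := expR (m ^+ 2 / (s ^+ 2 *+ 2)) * (normal_peak 1 / normal_peak s).
have K0 : 0 < K by rewrite /K mulr_gt0 ?expR_gt0// divr_gt0.
exists K => // d.
have wE (t : R) : expR (t * y - c * t ^+ 2 / 2) * normal_pdf 0 1 t =
    K * normal_pdf m s t.
  rewrite !normal_pdfE ?oner_neq0// /normal_fun /K mulrCA -expRD.
  transitivity (normal_peak 1 * (expR (m ^+ 2 / (s ^+ 2 *+ 2)) *
    expR (- (t - m) ^+ 2 / (s ^+ 2 *+ 2)))); last by field; rewrite gt_eqF.
  rewrite -expRD /m s2; congr (_ * expR _).
  by field; rewrite gt_eqF.
have mw : measurable_fun [set: R] (fun t : R => expR (t * y - c * t ^+ 2 / 2)).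
  by apply: continuous_measurable_fun => t; apply: (@drv_continuous _ t).
split.
- rewrite integral_normal_prob ?oner_neq0//.
  under eq_integral do rewrite wE EFinM.
  rewrite integralZl//; last exact: integrable_normal_pdf.
  by rewrite integral_normal_pdf mule1.
- rewrite integral_normal_prob ?oner_neq0//; last first.
    apply: measurable_funM => //; apply: measurable_funX.
    by apply: measurable_funB; [exact: measurable_cst|exact: measurable_id].
  rewrite -s2 -/m EFinM -(normal_second_moment m s0 d).
  rewrite integral_normal_prob//; last first.
    apply: measurable_funX.
    by apply: measurable_funB; [exact: measurable_cst|exact: measurable_id].
  rewrite -ge0_integralZl//; first last.
  - by rewrite lee_fin ltW.
  - by move=> t _; rewrite lee_fin mulr_ge0 ?sqr_ge0// normal_pdf_ge0.
  - apply/measurable_EFinP; apply: measurable_funM; last exact: measurable_normal_pdf.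
    apply: measurable_funX.
    by apply: measurable_funB; [exact: measurable_cst|exact: measurable_id].
  by apply: eq_integral => t _; rewrite -mulrA wE -EFinM; congr EFin; ring.
Qed.


(* The Bayes risk under beta ~ N_p(0, e^-1 I_p) is p / (1 + e), and e is arbitrary.
   J is the joint density of (beta, y) relative to N_p(0, I_p) x N_p(0, I_p), up
   to normalization. *)
Lemma risk_lower_bound p (delta : p.-tuple T -> p.-tuple T) : (0 < p)%N ->
  estimator delta -> (p%:R%:E <= ereal_sup (range (risk delta)))%E.
Proof.
move=> p0 mdelta.
pose z : p.-tuple T := nseq_tuple p (0 : R).
have z0 i : tnth z i = 0 by rewrite tnth_nseq.
set S := ereal_sup _.
have RS b : (risk delta b <= S)%E by apply: ereal_sup_ubound; exists b.
have R0 b : (0 <= risk delta b)%E.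
  by apply: integral_ge0 => y _; rewrite lee_fin sumr_ge0// => i _; exact: sqr_ge0.
have S0 : (0 <= S)%E by exact: le_trans (R0 z) (RS z).
case: S RS S0 => [r RS| _ _ |//]; last by rewrite leey.
rewrite !lee_fin => r0.
have pp : 0 < p%:R :> R by rewrite ltr0n.
suff key e : 0 < e -> p%:R * (1 + e)^-1 <= r.
  rewrite leNgt; apply/negP => rp.
  (* If r < p, this e makes p/(1+e) the midpoint (p + r)/2, which exceeds r. *)
  have e0 : 0 < (p%:R - r) / (p%:R + r) by rewrite divr_gt0//; lra.
  have := key _ e0.
  have -> : p%:R * (1 + (p%:R - r) / (p%:R + r))^-1 = (p%:R + r) / 2.
    by field; apply/andP; split; rewrite gt_eqF//; lra.
  lra.
move=> e0; have e1 : 0 < 1 + e by lra.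
pose J (b y : p.-tuple T) : R := \prod_(i < p) expR (tnth b i * tnth y i - e * tnth b i ^+ 2 / 2).
(* Unnormalized density of N_p(0, e^-1 I_p) relative to N_p(0, I_p); the term [* 0] matches
   [gaussian_weight] at y = 0. *)
pose P (b : p.-tuple T) : R := \prod_(i < p) expR (tnth b i * 0 - (e - 1) * tnth b i ^+ 2 / 2).
pose W (b y : p.-tuple T) : R := \prod_(i < p) expR (tnth b i * tnth y i - tnth b i ^+ 2 / 2).
have JE b y : J b y = W b y * P b.
  rewrite /J /W /P -big_split; apply: eq_bigr => i _ /=; rewrite -expRD; congr expR.
  by field.
have J0 b y : 0 <= J b y by apply: prodr_ge0 => i _; exact: expR_ge0.
have W0 b y : 0 <= W b y by apply: prodr_ge0 => i _; exact: expR_ge0.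
have P0 b : 0 <= P b by apply: prodr_ge0 => i _; exact: expR_ge0.
have mw (c y : R) : measurable_fun [set: R] (fun t : R => expR (t * y - c * t ^+ 2 / 2)).
  by apply: continuous_measurable_fun => t; apply: (@drv_continuous _ t).
have c1 (i : 'I_p) : measurable_fun [set: p.-tuple T * p.-tuple T] (fun u => tnth u.1 i : R).
  by apply: (measurableT_comp (measurable_tnth i)); exact: measurable_fst.
have c2 (i : 'I_p) : measurable_fun [set: p.-tuple T * p.-tuple T] (fun u => tnth u.2 i : R).
  by apply: (measurableT_comp (measurable_tnth i)); exact: measurable_snd.
have c3 (i : 'I_p) : measurable_fun [set: p.-tuple T * p.-tuple T] (fun u => tnth (delta u.2) i : R).
  apply: (measurableT_comp (measurable_tnth i)).
  by apply: (measurableT_comp mdelta); exact: measurable_snd.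
have mJ : measurable_fun [set: p.-tuple T * p.-tuple T] (fun u => J u.1 u.2).
  apply: measurable_prod => i _; apply: measurableT_comp => //.
  apply: measurable_funB; first exact: measurable_funM.
  apply: measurable_funM; last exact: measurable_cst.
  apply: measurable_funM; first exact: measurable_cst.
  exact: measurable_funX.
have mP : measurable_fun [set: p.-tuple T] P.
  by apply: measurable_prod => i _; exact: (measurable_coord _ (mw _ _)).
have mWb b : measurable_fun [set: p.-tuple T] (W b).
  apply: measurable_prod => i _.
  apply: (@measurable_coord _ _ _ (fun t : R => expR (tnth b i * t - tnth b i ^+ 2 / 2))).
  apply: measurableT_comp => //; apply: measurable_funB; last exact: measurable_cst.
  by apply: measurable_funM; [exact: measurable_cst|exact: measurable_id].
pose f (b y : p.-tuple T) : R := \sum_(i < p) (tnth (delta y) i - tnth b i) ^+ 2.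
have fE b y : sqnorm (subt (delta y) b) = f b y.
  by apply: eq_bigr => i _; rewrite tnth_mktuple.
have f0 b y : 0 <= f b y by apply: sumr_ge0 => i _; exact: sqr_ge0.
have mf : measurable_fun [set: p.-tuple T * p.-tuple T] (fun u => f u.1 u.2).
  apply: measurable_sum => i; apply: measurable_funX.
  exact: measurable_funB.
pose g := mvnormal z.
have [KP KP0 KPE] := @gaussian_weight (e - 1) 0 ltac:(lra).
have AE : (\int[g]_b (P b)%:E = (\prod_(i < p) KP)%:E)%E.
  apply: (integral_mvnormal_prod (k := fun _ t => expR (t * 0 - (e - 1) * t ^+ 2 / 2))).
  - by move=> i; exact: mw.
  - by move=> i t; exact: expR_ge0.
  - by move=> i; rewrite z0; have [] := KPE 0.
set a := \prod_(i < p) KP in AE.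
have a0 : 0 < a by apply: prodr_gt0 => i _.
(* Given y, each coordinate has posterior variance 1/(1+e), so no value of [delta y] has posterior
   expected loss below p/(1+e). *)
have post y : (\int[g]_b (f b y * J b y)%:E >=
    (p%:R * (1 + e)^-1)%:E * \int[g]_b (J b y)%:E)%E.
  have [K hK] : exists K : 'I_p -> R, forall i, 0 < K i /\ forall d : R,
    (\int[normal_prob 0 1]_t (expR (t * tnth y i - e * t ^+ 2 / 2))%:E = (K i)%:E)%E /\
    (\int[normal_prob 0 1]_t ((d - t) ^+ 2 * expR (t * tnth y i - e * t ^+ 2 / 2))%:E =
     (K i * ((1 + e)^-1 + (d - tnth y i / (1 + e)) ^+ 2))%:E)%E.
    exists (fun i => s2val (cid2 (gaussian_weight (tnth y i) e1))) => i.
    by case: (cid2 _) => /= k k0 kE; split.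
  have JI : (\int[g]_b (J b y)%:E = (\prod_(i < p) K i)%:E)%E.
    apply: (integral_mvnormal_prod (k := fun i t => expR (t * tnth y i - e * t ^+ 2 / 2))).
    - by move=> i; exact: mw.
    - by move=> i t; exact: expR_ge0.
    - by move=> i; rewrite z0; have [_ /(_ 0)[]] := hK i.
  have K0 : 0 < \prod_(i < p) K i by apply: prodr_gt0 => i _; have [] := hK i.
  pose dd i := tnth (delta y) i.
  have fI i : (\int[g]_b ((dd i - tnth b i) ^+ 2 * J b y)%:E =
      ((\prod_(i < p) K i) * ((1 + e)^-1 + (dd i - tnth y i / (1 + e)) ^+ 2))%:E)%E.
    (* The loss in coordinate i is put into the i-th factor of J, so the integrand stays a product
       over coordinates. *)
    pose q (j : 'I_p) (t : R) := (if j == i then (dd i - t) ^+ 2 else 1) *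
      expR (t * tnth y j - e * t ^+ 2 / 2).
    pose C j := K j * (if j == i then (1 + e)^-1 + (dd i - tnth y i / (1 + e)) ^+ 2 else 1).
    transitivity (\int[g]_b (\prod_(j < p) q j (tnth b j))%:E)%E.
      apply: eq_integral => b _; congr EFin; rewrite /q big_split/=; congr (_ * _).
      by rewrite -big_mkcond/= big_pred1_eq.
    rewrite (@integral_mvnormal_prod _ _ _ q C).
    - congr EFin; rewrite /C big_split/=; congr (_ * _).
      by rewrite -big_mkcond/= big_pred1_eq.
    - move=> j; apply: measurable_funM; last exact: mw.
      case: (j == i); last exact: measurable_cst.
      by apply: measurable_funX; apply: measurable_funB; [exact: measurable_cst|exact: measurable_id].
    - by move=> j t; rewrite /q mulr_ge0 ?expR_ge0//; case: (j == i) => //; exact: sqr_ge0.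
    - move=> j; rewrite z0 /q /C; have [_ h] := hK j.
      case: eqVneq => [ji|_]; first by have [_] := h (dd i); rewrite ji.
      by rewrite mulr1; under eq_integral do rewrite mul1r; have [] := h 0.
  rewrite JI -EFinM.
  have -> : (\int[g]_b (f b y * J b y)%:E =
     \sum_(i < p) \int[g]_b ((dd i - tnth b i) ^+ 2 * J b y)%:E)%E.
    rewrite -ge0_integral_sum//.
    - by apply: eq_integral => b _; rewrite sumEFin /f mulr_suml.
    - move=> i; apply/measurable_EFinP; apply: measurable_funM.
        apply: measurable_funX; apply: measurable_funB; first exact: measurable_cst.
        exact: measurable_tnth.
      exact: (measurable_fun_pair1 y mJ).
    - by move=> i b _; rewrite lee_fin mulr_ge0// sqr_ge0.
  rewrite (eq_bigr _ (fun i _ => fI i)).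
  rewrite sumEFin lee_fin -mulr_sumr mulrC; apply: ler_wpM2l; first exact: ltW.
  have -> : p%:R * (1 + e)^-1 = \sum_(i < p) (1 + e)^-1.
    by rewrite sumr_const card_ord mulr_natl.
  by apply: ler_sum => i _; rewrite lerDl sqr_ge0.
have mF : measurable_fun [set: p.-tuple T * p.-tuple T] (fun u => (f u.1 u.2 * J u.1 u.2)%:E).
  by apply/measurable_EFinP; exact: measurable_funM.
have mJ' : measurable_fun [set: p.-tuple T * p.-tuple T] (fun u => (J u.1 u.2)%:E).
  by apply/measurable_EFinP.
have mFI : measurable_fun [set: p.-tuple T] (fun b => \int[g]_y (f b y * J b y)%:E)%E.
  apply: (@measurable_fun_fubini_tonelli_F _ _ _ _ R g (fun u => (f u.1 u.2 * J u.1 u.2)%:E)) => //.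
  by move=> u; rewrite lee_fin; exact: mulr_ge0.
have mGI : measurable_fun [set: p.-tuple T] (fun y => \int[g]_b (f b y * J b y)%:E)%E.
  apply: (@measurable_fun_fubini_tonelli_G _ _ _ _ R g (fun u => (f u.1 u.2 * J u.1 u.2)%:E)) => //.
  by move=> u; rewrite lee_fin; exact: mulr_ge0.
have mJI : measurable_fun [set: p.-tuple T] (fun y => \int[g]_b (J b y)%:E)%E.
  apply: (@measurable_fun_fubini_tonelli_G _ _ _ _ R g (fun u => (J u.1 u.2)%:E)) => //.
  by move=> u; rewrite lee_fin; exact: J0.
have riskE b : (risk delta b * (P b)%:E = \int[g]_y (f b y * J b y)%:E)%E.
  rewrite /risk (mvnormal_density b z0).
  - rewrite -(@ge0_integralZr _ _ _ _ _ measurableT).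
    + by apply: eq_integral => y _; rewrite fE -!EFinM JE mulrA.
    + apply/measurable_EFinP; apply: measurable_funM; last exact: mWb.
      under eq_fun do rewrite fE; exact: (measurable_fun_pair2 b mf).
    + by move=> y _; rewrite -EFinM lee_fin fE; apply: mulr_ge0; [exact: f0|exact: W0].
    + by rewrite lee_fin.
  - apply/measurable_EFinP.
    by under eq_fun do rewrite fE; exact: (measurable_fun_pair2 b mf).
  - by move=> y; rewrite lee_fin fE.
(* The same double integral is bounded above by averaging the risk over the prior (L1) and below, in
   the other order, by the posterior bound (L3). *)
have L1 : (\int[g]_b \int[g]_y (f b y * J b y)%:E <= r%:E * a%:E)%E.
  rewrite -AE -ge0_integralZl//; last 2 first.
  - by apply/measurable_EFinP.
  - by move=> b _; rewrite lee_fin.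
  apply: ge0_le_integral.
  - exact: measurableT.
  - by move=> b _; apply: integral_ge0 => y _; rewrite lee_fin mulr_ge0.
  - exact: mFI.
  - by apply: emeasurable_funM; [exact: measurable_cst|apply/measurable_EFinP].
  - by move=> b _; rewrite -riskE; apply: lee_wpmul2r; rewrite ?lee_fin.
have L2 : (\int[g]_y \int[g]_b (J b y)%:E = a%:E)%E.
  rewrite -(@fubini_tonelli _ _ _ _ _ g g (fun u => (J u.1 u.2)%:E))//; last first.
    by move=> u; rewrite lee_fin; exact: J0.
  rewrite -AE; apply: eq_integral => b _ /=.
  transitivity (\int[g]_y ((P b)%:E * (W b y)%:E))%E.
    by apply: eq_integral => y _; rewrite -EFinM JE mulrC.
  rewrite ge0_integralZl//; last 3 first.
  - by apply/measurable_EFinP; exact: mWb.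
  - by move=> y _; rewrite lee_fin; exact: W0.
  - by rewrite lee_fin; exact: P0.
  suff -> : (\int[g]_y (W b y)%:E = 1)%E by rewrite mule1.
  transitivity (\int[mvnormal b]__ (1 : \bar R))%E.
    by rewrite (mvnormal_density b z0)//; apply: eq_integral => y _; rewrite mul1e.
  by rewrite integral_cst// mul1e; exact: probability_setT.
have L3 : ((p%:R * (1 + e)^-1)%:E * a%:E <= r%:E * a%:E)%E.
  apply: le_trans L1.
  rewrite (@fubini_tonelli _ _ _ _ _ g g (fun u => (f u.1 u.2 * J u.1 u.2)%:E))//=; last first.
    by move=> u; rewrite lee_fin mulr_ge0.
  rewrite -L2 -ge0_integralZl//; last 2 first.
  - by move=> y _; apply: integral_ge0 => b _; rewrite lee_fin.
  - by rewrite lee_fin mulr_ge0// invr_ge0 ltW.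
  apply: ge0_le_integral.
  - exact: measurableT.
  - move=> y _; apply: mule_ge0; first by rewrite lee_fin mulr_ge0// invr_ge0 ltW.
    by apply: integral_ge0 => b _; rewrite lee_fin.
  - apply: emeasurable_funM; first exact: measurable_cst.
    exact: mJI.
  - exact: mGI.
  - by move=> y _; exact: post.
by move: L3; rewrite -!EFinM lee_fin ler_pM2r.
Qed.
End risk_lower_bound.

(** * Moments of the posterior weight *)

Section bounded_continuous01.
Context {R : realType}.
Implicit Types f g : R -> R.

(** A class closed under the algebra used below and integrable against any integrable weight;
    nothing is asked at 0 or 1, where h and H may misbehave. *)
Definition bcont01 f := (forall k : R, 0 < k < 1 -> {for k, continuous f}) /\
  exists M, forall k : R, 0 < k < 1 -> `|f k| <= M.

Lemma bcont01_cst (r : R) : bcont01 (fun=> r).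
Proof. by split; [move=> k _; exact: cvg_cst|exists `|r|]. Qed.

Lemma bcont01_id : bcont01 (fun k => k).
Proof.
split; [by move=> k _; exact: cvg_id|exists 1 => k /andP[k0 k1]].
by rewrite ger0_norm ltW.
Qed.

Lemma bcont01D f g : bcont01 f -> bcont01 g -> bcont01 (fun k => f k + g k).
Proof.
move=> [cf [M fM]] [cg [N gN]]; split; first by move=> k k01; apply: cvgD; [exact: cf|exact: cg].
exists (M + N) => k k01; apply: le_trans (ler_normD _ _) _.
by apply: lerD; [exact: fM|exact: gN].
Qed.

Lemma bcont01M f g : bcont01 f -> bcont01 g -> bcont01 (fun k => f k * g k).
Proof.
move=> [cf [M fM]] [cg [N gN]]; split; first by move=> k k01; apply: cvgM; [exact: cf|exact: cg].
exists (M * N) => k k01; rewrite normrM.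
by apply: ler_pM => //; [exact: fM|exact: gN].
Qed.

Lemma bcont01N f : bcont01 f -> bcont01 (fun k => - f k).
Proof.
move=> [cf [M fM]]; split; first by move=> k k01; apply: cvgN; exact: cf.
by exists M => k k01; rewrite normrN; exact: fM.
Qed.

Lemma bcont01B f g : bcont01 f -> bcont01 g -> bcont01 (fun k => f k - g k).
Proof. by move=> cf cg; apply: bcont01D => //; exact: bcont01N. Qed.

Lemma bcont01_expR f : bcont01 f -> bcont01 (fun k => expR (f k)).
Proof.
move=> [cf [M fM]]; split.
  by move=> k k01; apply: continuous_comp; [exact: cf|exact: continuous_expR].
exists (expR M) => k k01; rewrite ger0_norm ?expR_ge0// ler_expR.
exact: le_trans (ler_norm _) (fM _ k01).
Qed.

Lemma measurable_continuous01 f : (forall k : R, 0 < k < 1 -> {for k, continuous f}) ->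
  measurable_fun (`]0, 1[%classic : set R) f.
Proof.
move=> cf; apply: open_continuous_measurable_fun; first exact: interval_open.
by move=> k /set_mem/=; rewrite in_itv; exact: cf.
Qed.
End bounded_continuous01.

(** Here r = e1/e0, A = v e2/e1 and x e0 is the integral of (1-k)(-H). By the last hypothesis the
    goal reads x + 2A + r (c + b - A) <= p + c. The crux is b x <= (2 - r) X: with it, b times the
    left side is at most 2 (c + 1) - r (1 - b)(c + 1 + b), hence at most b (p + c). *)
Lemma dominance_arithmetic (R : realType) (b c p v r A x : R) :
  0 < b -> b < 1 -> 0 < c -> c + 2 < p -> 2 * (c + 1) <= b * (p + c) ->
  p < 2 * A -> A <= v -> 0 < r -> r <= 1 -> 0 <= x ->
  0 <= c + 1 - b * A -> x * (1 - expR (- v)) <= c + 1 - b * A ->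
  c * (1 - r) - b * r - x - v * r + A * r = 0 ->
  2 * A - v * r <= p.
Proof.
move=> b0 b1 c0 cp bp Ap Av r0 r1 x0; set X := _ - _ => X0; set d := 1 - _ => J3 J0.
have rcb : r * (c + b) <= c.
  have : 0 <= (v - A) * r by apply: mulr_ge0; [rewrite subr_ge0|exact: ltW].
  lra.
(* Since v >= A > p/2, exp(v) >= (1 + v/2)^2 >= (1 + p/4)^2 >= p > c + 2, so d >= 1 - 1/(c + 2). *)
have dc : c + 1 <= d * (c + 2).
  have ev : c + 2 <= expR v.
    have -> : expR v = expR (v / 2) * expR (v / 2) by rewrite -expRD -splitr.
    have e1v := expR_ge1Dx (v / 2).
    have : (1 + v / 2) * (1 + v / 2) <= expR (v / 2) * expR (v / 2).
      by apply: ler_pM => //; lra.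
    have := sqr_ge0 (1 - p / 4); have : (1 + p / 4) * (1 + p / 4) <= (1 + v / 2) * (1 + v / 2).
      by apply: ler_pM; lra.
    move=> j1 j2 j3; lra.
  rewrite /d mulrBl mul1r.
  have : expR (- v) * (c + 2) <= 1 by rewrite expRN mulrC ler_pdivrMr ?expR_gt0// mul1r.
  lra.
have d0 : 0 <= d by rewrite /d subr_ge0 -[leRHS]expR0 ler_expR; lra.
(* From r <= c/(c+b), 2 - r >= 1 + b/(c+b) >= 1 + b/(c+1). Multiplied by d >= (c+1)/(c+2) this gives
   (c+1+b)/(c+2), which is at least b because b < 1. *)
have J4 : b <= (2 - r) * d.
  have cb : 0 < c + b by exact: addr_gt0.
  have r2 : (c + b + b) / (c + b) <= 2 - r.
    rewrite ler_pdivrMr//; lra.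
  have r3 : (c + 1 + b) / (c + 1) <= (c + b + b) / (c + b).
    rewrite ler_pdivrMr; last lra.
    rewrite mulrAC ler_pdivlMr//.
    have : 0 <= b * (1 - b) by apply: mulr_ge0; [exact: ltW|rewrite subr_ge0 ltW].
    lra.
  apply: (@le_trans _ _ ((c + 1 + b) / (c + 1) * ((c + 1) / (c + 2)))); last first.
    apply: ler_pM.
    - by rewrite divr_ge0//; lra.
    - by rewrite divr_ge0//; lra.
    - exact: le_trans r3 r2.
    - by rewrite ler_pdivrMr; [exact: dc|lra].
  have -> : (c + 1 + b) / (c + 1) * ((c + 1) / (c + 2)) = (c + 1 + b) / (c + 2).
    by field; apply/andP; split; rewrite gt_eqF//; lra.
  rewrite ler_pdivlMr; last by have := c0; lra.
  have : 0 <= (1 - b) * (c + 1).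
    by apply: mulr_ge0; [rewrite subr_ge0 ltW|have := c0; lra].
  lra.
have J5 : b * x <= (2 - r) * X.
  apply: (@le_trans _ _ ((2 - r) * d * x)); first exact: ler_wpM2r.
  rewrite -mulrA (mulrC d); apply: ler_wpM2l => //.
  lra.
have key : b * (x + 2 * A + r * (c + b - A)) <= b * (p + c).
  have [dl|dl] := leP (c + b - A) 0.
    have : r * (c + b - A) <= 0 by rewrite pmulr_rle0.
    have rX : 0 <= r * X by apply: mulr_ge0 => //; exact: ltW.
    move=> rA; have : b * (r * (c + b - A)) <= 0 by rewrite pmulr_rle0.
    rewrite /X in rX J5; lra.
  have XE : X = (1 - b) * (c + 1 + b) + b * (c + b - A) by rewrite /X; ring.
  have XX : 0 <= (1 - b) * (c + 1 + b).
    by apply: mulr_ge0; [rewrite subr_ge0 ltW|have := c0; have := b0; lra].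
  have : 0 <= r * ((1 - b) * (c + 1 + b)) by apply: mulr_ge0 => //; exact: ltW.
  have : r * X = r * ((1 - b) * (c + 1 + b)) + b * (r * (c + b - A)) by rewrite XE; ring.
  move=> h1 h2; rewrite /X in J5 h1; lra.
rewrite ler_pM2l// in key.
lra.
Qed.

(** * Integrals against u(k) exp(-v k) and their dependence on v *)

Section weighted_integral.
Context {R : realType}.
Local Notation mu := (@lebesgue_measure R).
Variable u : R -> R.
Hypothesis u_gt0 : forall k : R, 0 < k < 1 -> 0 < u k.
Hypothesis cu : forall k : R, 0 < k < 1 -> {for k, continuous u}.
Hypothesis intu : mu.-integrable `]0, 1[ (EFin \o u).

(** Unnormalized posterior expectation of f(kappa) when |y|^2 = 2v. *)
Definition wint (v : R) (f : R -> R) : R :=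
  \int[mu]_(k in `]0, 1[) (u k * expR (- (v * k)) * f k).

Let bexp v : bcont01 (fun k : R => expR (- (v * k))).
Proof.
by apply: bcont01_expR; apply: bcont01N; apply: bcont01M; [exact: bcont01_cst|exact: bcont01_id].
Qed.

Lemma integrable_wt f : bcont01 f -> mu.-integrable `]0, 1[ (fun k => (u k * f k)%:E).
Proof.
move=> [cf [M fM]].
apply: (@le_integrable _ _ _ mu `]0, 1[ _ _ (fun k => (M * u k)%:E)) => //.
- apply/measurable_EFinP; apply: measurable_continuous01 => k k01.
  by apply: cvgM; [exact: cu|exact: cf].
- move=> k /=; rewrite in_itv/= => k01; rewrite lee_fin.
  apply: le_trans (ler_norm _); rewrite normrM mulrC (gtr0_norm (u_gt0 k01)).
  by apply: ler_wpM2r; [exact: ltW (u_gt0 k01)|exact: fM].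
- exact: (integrableZl _ M intu).
Qed.

Lemma integrable_wint v f : bcont01 f ->
  mu.-integrable `]0, 1[ (fun k => (u k * expR (- (v * k)) * f k)%:E).
Proof.
move=> bf; apply: eq_integrable (integrable_wt (bcont01M (bexp v) bf)) => //.
by move=> k _; rewrite mulrA.
Qed.

Lemma eq_wint v f g : (forall k : R, 0 < k < 1 -> f k = g k) -> wint v f = wint v g.
Proof.
by move=> fg; apply: eq_Rintegral => k /set_mem/=; rewrite in_itv => /fg ->.
Qed.

Lemma wintD v f g : bcont01 f -> bcont01 g ->
  wint v (fun k => f k + g k) = wint v f + wint v g.
Proof.
move=> bf bg; rewrite /wint -RintegralD//; [|exact: integrable_wint..].
by apply: eq_Rintegral => k _; rewrite mulrDr.
Qed.

Lemma wintZ v f r : bcont01 f -> wint v (fun k => r * f k) = r * wint v f.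
Proof.
move=> bf; rewrite /wint -RintegralZl//; last exact: integrable_wint.
by apply: eq_Rintegral => k _; rewrite mulrCA.
Qed.

Lemma wintN v f : bcont01 f -> wint v (fun k => - f k) = - wint v f.
Proof.
move=> bf; rewrite -mulN1r -wintZ//; apply: eq_wint => k _; by rewrite mulN1r.
Qed.

Lemma wintB v f g : bcont01 f -> bcont01 g ->
  wint v (fun k => f k - g k) = wint v f - wint v g.
Proof. by move=> bf bg; rewrite wintD ?wintN//; exact: bcont01N. Qed.

Lemma le_wint v f g : bcont01 f -> bcont01 g ->
  (forall k : R, 0 < k < 1 -> f k <= g k) -> wint v f <= wint v g.
Proof.
move=> bf bg fg; apply: le_Rintegral => //; [exact: integrable_wint..|].
move=> k /=; rewrite in_itv => k01; apply: ler_wpM2l; last exact: fg.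
by rewrite mulr_ge0 ?expR_ge0// ltW// u_gt0.
Qed.

Lemma wint_ge0 v f : (forall k : R, 0 < k < 1 -> 0 <= f k) -> 0 <= wint v f.
Proof.
move=> f0; apply: Rintegral_ge0 => k /=; rewrite in_itv => k01.
by rewrite mulr_ge0 ?f0// mulr_ge0 ?expR_ge0// ltW// u_gt0.
Qed.

(** A zero integral would make a strictly positive integrand vanish almost everywhere on an interval
    of measure 1. *)
Lemma wint_gt0 v f : bcont01 f -> (forall k : R, 0 < k < 1 -> 0 < f k) -> 0 < wint v f.
Proof.
move=> bf f0; rewrite lt_neqAle wint_ge0 ?andbT; last by move=> k /f0/ltW.
apply/eqP => /esym E0.
have intf := integrable_wint v bf.
have pos k : `]0%R, 1%R[%classic k -> 0 < u k * expR (- (v * k)) * f k.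
  by rewrite /= in_itv/= => k01; rewrite mulr_gt0 ?f0// mulr_gt0 ?expR_gt0// u_gt0.
have : (\int[mu]_(k in `]0%R, 1%R[) `|(u k * expR (- (v * k)) * f k)%:E| = 0)%E.
  transitivity (\int[mu]_(k in `]0%R, 1%R[) (u k * expR (- (v * k)) * f k)%:E)%E.
    by apply: eq_integral => k /set_mem k01; rewrite gee0_abs// lee_fin ltW// pos.
  rewrite -(fineK (integrable_fin_num _ intf))//.
  by congr EFin.
move/(ae_eq_integral_abs mu _ (measurable_int _ intf)) => /(_ _)/= [].
  by [].
move=> N [mN N0 sN].
have : (mu `]0%R, 1%R[ <= mu N)%E.
  apply: le_measure; rewrite ?inE//; move=> k k01; apply: sN => /= /(_ k01) [] /eqP.
  by rewrite gt_eqF// pos.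
by rewrite N0 lebesgue_measure_itv/= lte_fin ltr01 oppr0 adde0 lee_fin ler10.
Qed.

Lemma der_wint f (w : R) : bcont01 f ->
  is_derive w (1 : R) (fun w => wint (w / 2) f) (- (2^-1 * wint (w / 2) (fun k => k * f k))).
Proof.
move=> bf; have [_ [M fM]] := bf.
pose FF x k := u k * expR (- (x / 2 * k)) * f k.
have dFF (x k : R) : is_derive x (1 : R) (FF ^~ k) (- (2^-1 * k) * FF x k).
  apply: (is_derive_eq (drv_mul (drv_mul (drv_cst x _) (drv_expR (drv_opp
    (drv_mul (drv_mul (is_derive_id x 1) (drv_cst x 2^-1)) (drv_cst x k))))) (drv_cst x _))).
  by rewrite /FF/=; ring.
have d1E x k : partial1of2 FF x k = - (2^-1 * k) * FF x k.
  by rewrite partial1of2E; have [_ <-] := dFF x k.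
have M0 : 0 <= M.
  by apply: le_trans (normr_ge0 _) (fM 2^-1 _); rewrite invr_gt0 ltr0n/= invf_lt1// ltr1n.
(* Dominates the derivative in x uniformly over |x - w| < 1: there -x/2 k <= |w| + 1, and the factor
   k/2 is at most 1. *)
pose G k := M * expR (`|w| + 1) * `|u k|.
have wI : `]w - 1, w + 1[%classic w by rewrite /= in_itv/= ltrBlDr ltrDl ltr01.
have h1 x : `]w - 1, w + 1[%classic x -> mu.-integrable `]0, 1[ (EFin \o FF x).
  by move=> _; exact: integrable_wint.
have h2 x k : `]w - 1, w + 1[%classic x -> `]0, 1[%classic k -> derivable (FF ^~ k) x 1.
  by move=> _ _; have [] := dFF x k.
have G0 k : 0 <= G k by rewrite /G !mulr_ge0 ?expR_ge0.
have iG : mu.-integrable `]0, 1[ (EFin \o G).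
  exact: (integrableZl _ (M * expR (`|w| + 1)) (integrable_abse intu)).
have h3 x k : `]w - 1, w + 1[%classic x -> `]0, 1[%classic k ->
    `|partial1of2 FF x k| <= G k.
  rewrite /= !in_itv/= => xw k01; rewrite d1E /FF /G !normrM normrN normrM.
  rewrite (ger0_norm (expR_ge0 _)).
  have k1 : `|2^-1| * `|k| <= 1.
    by rewrite (gtr0_norm (_ : 0 < k)) ?ger0_norm ?invr_ge0//; lra.
  have e1 : expR (- (x / 2 * k)) <= expR (`|w| + 1).
    rewrite ler_expR.
    have x1 : - x <= `|w| + 1 by have := ler_norm (- w); rewrite normrN; lra.
    have := normr_ge0 w; nra.
  have := fM k k01; have := normr_ge0 (f k); have := normr_ge0 (u k); move=> u0 f0 fle.
  apply: (@le_trans _ _ (1 * (`|u k| * expR (`|w| + 1) * M))).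
    apply: ler_pM => //.
    by apply: ler_pM => //; apply: ler_wpM2l.
  by rewrite le_eqVlt; apply/orP; left; apply/eqP; ring.
have md : measurable (`]0, 1[%classic : set (measurableTypeR R)) by exact: measurable_itv.
have D1 := @derivable_under_integral R _ _ mu FF `]0, 1[ md w (w - 1) (w + 1) wI h1 h2 G G0 iG h3.
have D2 := @differentiation_under_integral R _ _ mu FF `]0, 1[ md w (w - 1) (w + 1) wI h1 h2 G G0 iG h3.
apply: (DeriveDef D1); rewrite -derive1E D2.
have bkf : bcont01 (fun k => k * f k) by apply: bcont01M => //; exact: bcont01_id.
rewrite -(wintZ _ _ bkf) -wintN; last by apply: bcont01M => //; exact: bcont01_cst.
by apply: eq_Rintegral => k _; rewrite d1E /FF; ring.
Qed.

Lemma continuous_wint f : bcont01 f -> continuous ((fun w => wint (w / 2) f) : R -> R).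
Proof. by move=> bf w; exact: drv_continuous (der_wint w bf). Qed.
End weighted_integral.

(** * Integrations by parts for the posterior weight and the resulting moment inequalities *)

Section prior_weight.
Context {R : realType}.
Local Notation mu := (@lebesgue_measure R).
Variables (c b B : R) (h hp : R -> R).
Hypothesis c0 : 0 <= c.
Hypothesis b0 : 0 < b.
Hypothesis b1 : b < 1.
Hypothesis h0 : forall k : R, 0 < k < 1 -> 0 < h k.
Hypothesis dh : forall k : R, 0 < k < 1 -> is_derive k (1 : R) h (hp k).
Hypothesis chp : forall k : R, 0 < k < 1 -> {for k, continuous hp}.
Hypothesis hpB : forall k : R, 0 < k < 1 -> `|k * hp k / h k| <= B.
Hypothesis h_at0 : forall e, 0 < e -> k `^ e * h k @[k --> (0 : R)^'+] --> (0 : R).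
Hypothesis h_at1 : exists h1 : R, h k @[k --> (1 : R)^'-] --> h1.

Let u (k : R) := k `^ (c - 1) * (1 - k) `^ (b - 1) * h k.
Hypothesis intu : mu.-integrable `]0, 1[ (EFin \o u).
Let H (k : R) := k * hp k / h k.
Let E v f := wint u v f.

Let u0 (k : R) : 0 < k < 1 -> 0 < u k.
Proof.
move=> k01; rewrite /u mulr_gt0 ?h0//; case/andP: k01 => k0 k1.
by rewrite mulr_gt0// powR_gt0// subr_gt0.
Qed.

Let ch (k : R) : 0 < k < 1 -> {for k, continuous h}.
Proof. by move=> k01; exact: drv_continuous (dh k01). Qed.

Let d1m (k : R) : is_derive k (1 : R) (fun k => 1 - k) (-1).
Proof.
by apply: (is_derive_eq (drv_add (drv_cst k 1) (drv_opp (is_derive_id k 1)))); rewrite add0r.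
Qed.

Let dpow (e k : R) : 0 < k -> is_derive k (1 : R) (fun k => k `^ e) (e * k `^ (e - 1)).
Proof. by move=> k0; apply: (is_derive_eq (drv_powR e k0 (is_derive_id k 1))); rewrite mul1r. Qed.

Let dpow1 (e k : R) : k < 1 ->
  is_derive k (1 : R) (fun k => (1 - k) `^ e) (- (e * (1 - k) `^ (e - 1))).
Proof.
move=> k1; have z0 : 0 < 1 - k by rewrite subr_gt0.
by apply: (is_derive_eq (@drv_powR _ _ (fun k => 1 - k) _ e z0 (d1m k))); rewrite mulN1r.
Qed.

Let cu (k : R) : 0 < k < 1 -> {for k, continuous u}.
Proof.
move=> k01; case/andP: (k01) => k0 k1.
apply: cvgM; last exact: ch.
apply: cvgM; first exact: drv_continuous (dpow _ k0).
exact: drv_continuous (dpow1 _ k1).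
Qed.

Let bH : bcont01 H.
Proof.
split; last by exists B.
move=> k k01; apply: cvgM.
  by apply: cvgM; [exact: cvg_id|exact: chp].
by apply: cvgV; [rewrite gt_eqF// h0|exact: ch].
Qed.

Let bz : bcont01 (fun k : R => 1 - k).
Proof. by apply: bcont01B; [exact: bcont01_cst|exact: bcont01_id]. Qed.

Let F0 v (k : R) := k `^ c * (1 - k) `^ b * h k * expR (- (v * k)).
Let f0 v (k : R) := c * (1 - k) - b * k + (1 - k) * H k - v * (k * (1 - k)).

Let bf0 v : bcont01 (f0 v).
Proof.
apply: bcont01B; last first.
  by apply: bcont01M; [exact: bcont01_cst|apply: bcont01M => //; exact: bcont01_id].
apply: bcont01D; last exact: bcont01M.
by apply: bcont01B; apply: bcont01M => //; (exact: bcont01_cst || exact: bcont01_id).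
Qed.

Let dF0 v (k : R) : 0 < k < 1 ->
  is_derive k (1 : R) (F0 v) (u k * expR (- (v * k)) * f0 v k).
Proof.
move=> k01; case/andP: (k01) => k0 k1; have hk := h0 k01.
have z0 : 0 < 1 - k by rewrite subr_gt0.
apply: (is_derive_eq (drv_mul (drv_mul (drv_mul (dpow c k0) (dpow1 b k1)) (dh k01))
  (drv_expR (drv_opp (drv_mul (drv_cst k v) (is_derive_id k 1)))))).
rewrite /u /f0 /H.
rewrite -(powR_mulB1 c k0) -(powR_mulB1 b z0).
by field; rewrite gt_eqF.
Qed.

Let cint v f : bcont01 f ->
  forall k : R, 0 < k < 1 -> {for k, continuous (fun k => u k * expR (- (v * k)) * f k)}.
Proof.
move=> [cf _] k k01; apply: cvgM; last exact: cf.
apply: cvgM; first exact: cu.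
exact: drv_continuous (drv_expR (drv_opp (drv_mul (drv_cst k v) (is_derive_id k 1)))).
Qed.

Let dexp v (k : R) : is_derive k (1 : R) (fun k => expR (- (v * k))) (- v * expR (- (v * k))).
Proof.
apply: (is_derive_eq (drv_expR (drv_opp (drv_mul (drv_cst k v) (is_derive_id k (1 : R)))))).
by rewrite /=; ring.
Qed.

Let z_at1 : (1 - k) `^ b @[k --> (1 : R)^'-] --> (0 : R).
Proof.
have : (1 - k) @[k --> (1 : R)^'-] --> (0 : R)^'+.
  have zz : (1 - k) @[k --> (1 : R)] --> (0 : R).
    by rewrite -[X in _ --> X](subrr (1 : R)); exact: drv_continuous (d1m 1).
  move=> A /zz zA.
  apply: (@filterS _ (nbhs (1 : R)) _ (fun k => 0 < 1 - k -> A (1 - k))) zA => k.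
  by rewrite subr_gt0.
by move=> zc; exact: (cvg_comp _ _ zc (powR_cvg0 b0)).
Qed.

Let F0_at1 v : F0 v k @[k --> (1 : R)^'-] --> (0 : R).
Proof.
have [h1 hh1] := h_at1.
rewrite (_ : 0 = 1 `^ c * 0 * h1 * expR (- (v * 1))); last by rewrite mulr0 !mul0r.
apply: cvgM; last first.
  apply: cvg_at_left_filter.
  exact: drv_continuous (drv_expR (drv_opp (drv_mul (drv_cst (1 : R) v) (is_derive_id (1 : R) (1 : R))))).
apply: cvgM => //; apply: cvgM.
  by apply: cvg_at_left_filter; exact: drv_continuous (dpow _ ltr01).
exact: z_at1.
Qed.

(** Holds at c = 0 too: the boundary term at 0 enters with a favourable sign, so its limit need not
    be known. *)
Lemma ibp0_le v : E v (f0 v) <= 0.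
Proof.
apply: (@FTC01_le R _ (F0 v)).
- by move=> k; exact: dF0.
- by move=> k; apply: cint.
- exact: integrable_wint.
- move=> k k01; rewrite /F0 !mulr_ge0 ?powR_ge0 ?expR_ge0// ltW// h0//.
- exact: F0_at1.
Qed.

Lemma ibp0_eq v : 0 < c -> E v (f0 v) = 0.
Proof.
move=> cp; rewrite -[RHS](subr0 0); apply: (@FTC01 R _ (F0 v)).
- by move=> k; exact: dF0.
- by move=> k; apply: cint.
- exact: integrable_wint.
- have -> : F0 v = fun k => k `^ c * h k * ((1 - k) `^ b * expR (- (v * k))).
    by apply/funext => k; rewrite /F0; ring.
  rewrite -[X in _ --> X](mul0r ((1 - 0) `^ b * expR (- (v * 0)))).
  apply: cvgM; first exact: h_at0.
  by apply: cvg_at_right_filter; apply: cvgM;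
    [exact: drv_continuous (dpow1 b ltr01)|exact: (drv_continuous (dexp v 0))].
- exact: F0_at1.
Qed.

(** Defined by exp(-v k) - exp(-v) = exp(-v k) g(k), so the second product can be written with the
    same weight as the first. The quotient [q] below stays bounded by v up to k = 1. *)
Let g v (k : R) := 1 - expR (- (v * (1 - k))).
Let q v (k : R) := g v k / (1 - k).
Let F1 v (k : R) := k `^ (c + 1) * h k * (1 - k) `^ (b - 1) *
  (expR (- (v * k)) - expR (- v)).
Let f1 v (k : R) := k * ((c + 1 + H k) * g v k - v * k + (1 - b) * (k * q v k)).

Let g_ge0 v (k : R) : 0 <= v -> 0 < k < 1 -> 0 <= g v k.
Proof.
move=> v0 k01; rewrite /g subr_ge0 -[leRHS]expR0 ler_expR oppr_le0 mulr_ge0//; lra.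
Qed.

Let g_le1 v (k : R) : g v k <= 1.
Proof. by rewrite /g lerBlDr lerDl expR_ge0. Qed.

Let g_le v (k : R) : g v k <= v * (1 - k).
Proof. by rewrite /g; have := expR_ge1Dx (- (v * (1 - k))); lra. Qed.

Let bg v : 0 <= v -> bcont01 (g v).
Proof.
move=> v0; apply: bcont01B; first exact: bcont01_cst.
by apply: bcont01_expR; apply: bcont01N; apply: bcont01M => //; exact: bcont01_cst.
Qed.

Let bq v : 0 <= v -> bcont01 (q v).
Proof.
move=> v0; split.
  move=> k /[dup] k01 /andP[_ k1]; apply: cvgM; first by have [+ _] := bg v0; exact.
  by apply: cvgV; [rewrite gt_eqF// subr_gt0|exact: drv_continuous (d1m k)].
exists v => k /[dup] k01 /andP[_ k1]; have z0 : 0 < 1 - k by rewrite subr_gt0.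
by rewrite ger0_norm /q ?ler_pdivrMr ?g_le// divr_ge0 ?g_ge0// ltW.
Qed.

Let bf1 v : 0 <= v -> bcont01 (f1 v).
Proof.
move=> v0; apply: bcont01M; first exact: bcont01_id.
apply: bcont01D.
  apply: bcont01B; last by apply: bcont01M; [exact: bcont01_cst|exact: bcont01_id].
  apply: bcont01M; last exact: bg.
  by apply: bcont01D => //; exact: bcont01_cst.
apply: bcont01M; first exact: bcont01_cst.
by apply: bcont01M; [exact: bcont01_id|exact: bq].
Qed.

Let dF1 v (k : R) : 0 < k < 1 ->
  is_derive k (1 : R) (F1 v) (u k * expR (- (v * k)) * f1 v k).
Proof.
move=> k01; case/andP: (k01) => k0 k1; have hk := h0 k01.
have z0 : 0 < 1 - k by rewrite subr_gt0.
apply: (is_derive_eq (drv_mul (drv_mul (drv_mul (dpow (c + 1) k0) (dh k01)) (dpow1 (b - 1) k1))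
  (drv_add (dexp v k) (drv_cst k (- expR (- v)))))).
rewrite /u /f1 /H /q /g addrK.
have -> : expR (- v) = expR (- (v * k)) * expR (- (v * (1 - k))).
  by rewrite -expRD; congr expR; ring.
have -> : k `^ (c + 1) = k * (k * k `^ (c - 1)).
  by rewrite (powR_mulB1 c k0) -(powR_mulB1 (c + 1) k0) addrK.
rewrite -(powR_mulB1 c k0) -(powR_mulB1 (b - 1) z0).
by field; rewrite !gt_eqF.
Qed.

Let F1_at1 v : 0 <= v -> F1 v k @[k --> (1 : R)^'-] --> (0 : R).
Proof.
move=> v0; have [h1 hh1] := h_at1.
apply/norm_cvg0P.
apply: (@squeeze_cvgr _ _ _ _ (fun=> 0) (fun k => (v * `|k `^ (c + 1) * h k|) * (1 - k) `^ b)).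
- near=> k.
  have k01 : 0 < k < 1.
    apply/andP; split; near: k; first by apply: nbhs_left_gt.
    exact: nbhs_left_lt.
  case/andP: (k01) => k0 k1; have z0 : 0 < 1 - k by rewrite subr_gt0.
  rewrite normr_ge0/= /F1 2!normrM (ger0_norm (powR_ge0 _ _)).
  have -> : expR (- (v * k)) - expR (- v) = expR (- (v * k)) * g v k.
    by rewrite /g mulrBr mulr1 -expRD; congr (_ - expR _); ring.
  rewrite [`|expR _ * _|]ger0_norm; last by rewrite mulr_ge0 ?expR_ge0 ?g_ge0.
  rewrite -(powR_mulB1 b z0).
  have e1 : expR (- (v * k)) <= 1 by rewrite -expR0 ler_expR oppr_le0 mulr_ge0// ltW.
  have eg : expR (- (v * k)) * g v k <= v * (1 - k).
    apply: le_trans (g_le v k); apply: ler_piMl => //; exact: g_ge0.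
  have := normr_ge0 (k `^ (c + 1) * h k); have := powR_ge0 (1 - k) (b - 1).
  move: (`|_|) ((1 - k) `^ _) => X Y Y0 X0.
  have -> : v * X * ((1 - k) * Y) = X * Y * (v * (1 - k)) by ring.
  by apply: ler_wpM2l => //; exact: mulr_ge0.
- exact: cvg_cst.
- rewrite -[X in _ --> X](mulr0 (v * `|1 `^ (c + 1) * h1|)); apply: cvgM; last exact: z_at1.
  apply: cvgM; first exact: cvg_cst.
  apply: cvg_norm; apply: cvgM => //.
  by apply: cvg_at_left_filter; exact: drv_continuous (dpow _ ltr01).
Unshelve. all: by end_near. Qed.

Let F1_at0 v : F1 v k @[k --> (0 : R)^'+] --> (0 : R).
Proof.
have -> : F1 v = fun k => k `^ (c + 1) * h k * ((1 - k) `^ (b - 1) * (expR (- (v * k)) - expR (- v))).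
  by apply/funext => k; rewrite /F1; ring.
rewrite -[X in _ --> X](mul0r ((1 - 0) `^ (b - 1) * (expR (- (v * 0)) - expR (- v)))).
apply: cvgM; first by apply: h_at0; rewrite ltr_wpDl.
apply: cvg_at_right_filter; apply: cvgM; first exact: drv_continuous (dpow1 _ ltr01).
by apply: cvgB; [exact: (drv_continuous (dexp v 0))|exact: cvg_cst].
Qed.

(** [f1] integrates to 0, both boundary terms being 0; replacing [q] by its bound v turns v k -
    (1-b) k q into at least b v k. *)
Lemma ibp1 v : 0 <= v ->
  b * v * E v (fun k => k * k) <= E v (fun k => k * ((c + 1 + H k) * g v k)).
Proof.
move=> v0.
have E0 : E v (f1 v) = 0.
  rewrite -[RHS](subr0 0); apply: (@FTC01 R _ (F1 v)).
  - by move=> k; exact: dF1.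
  - by move=> k; apply: cint; exact: bf1.
  - by apply: integrable_wint => //; exact: bf1.
  - exact: F1_at0.
  - exact: F1_at1.
have bkk : bcont01 (fun k : R => k * k) by apply: bcont01M; exact: bcont01_id.
have bH1 : bcont01 (fun k : R => k * ((c + 1 + H k) * g v k)).
  apply: bcont01M; first exact: bcont01_id.
  apply: bcont01M; last exact: bg.
  by apply: bcont01D => //; exact: bcont01_cst.
rewrite -subr_ge0 -(wintZ u0 cu intu v _ bkk) -(wintB u0 cu intu) //; last first.
  by apply: bcont01M => //; exact: bcont01_cst.
rewrite -[leLHS]E0; apply: (le_wint u0 cu intu); first exact: bf1.
  by apply: bcont01B => //; apply: bcont01M => //; exact: bcont01_cst.
move=> k k01; case/andP: (k01) => k0 k1; have z0 : 0 < 1 - k by rewrite subr_gt0.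
have qv : q v k <= v by rewrite /q ler_pdivrMr// g_le.
have : (1 - b) * (k * k) * q v k <= (1 - b) * (k * k) * v.
  by apply: ler_wpM2l => //; rewrite !mulr_ge0// ?subr_ge0 ltW.
rewrite /f1; lra.
Qed.


Section moments.
Variables (p v : R).
Hypothesis v0 : 0 <= v.

Let e0 := E v (fun=> 1).
Let e1 := E v (fun k => k).
Let e2 := E v (fun k => k * k).

Let b1' : bcont01 ((fun=> 1) : R -> R) := bcont01_cst 1.
Let bk : bcont01 (fun k : R => k) := bcont01_id.
Let bkk : bcont01 (fun k : R => k * k) := bcont01M bk bk.

Let wD := wintD u0 cu intu v.
Let wB := wintB u0 cu intu v.
Let wZ r f (bf : bcont01 f) := wintZ u0 cu intu v r bf.
Let wle f f' (bf : bcont01 f) (bf' : bcont01 f') := le_wint u0 cu intu v bf bf'.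
Let wpos := wint_gt0 u0 cu intu v.

Lemma moment0_gt0 : 0 < e0.
Proof. by apply: wpos => // k _; exact: ltr01. Qed.

Lemma moment1_gt0 : 0 < e1.
Proof. by apply: wpos => // k /andP[]. Qed.

Lemma moment2_gt0 : 0 < e2.
Proof. by apply: wpos => // k /andP[k0 _]; exact: mulr_gt0. Qed.

Lemma moment1_le : e1 <= e0.
Proof. by apply: wle => // k /andP[_ /ltW]. Qed.

Lemma moment2_le : e2 <= e1.
Proof. by apply: wle => // k /andP[k0 k1]; rewrite ler_piMr// ltW. Qed.

(** Cauchy-Schwarz, from the integral of (k - e1/e0)^2. It shows that the shrinkage factor e1/e0
    does not increase with |y|. *)
Lemma moment1_sqr : e1 * e1 <= e0 * e2.
Proof.
pose r := e1 / e0; have p0 := moment0_gt0.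
have br : bcont01 (fun k : R => 2 * r * k) by apply: bcont01M => //; exact: bcont01_cst.
have brr : bcont01 ((fun k : R => r * r * 1) : R -> R) by apply: bcont01M; exact: bcont01_cst.
have : 0 <= E v (fun k => (k * k - 2 * r * k) + r * r * 1).
  apply: (wint_ge0 u0) => k _.
  have -> : k * k - 2 * r * k + r * r * 1 = (k - r) ^+ 2 by ring.
  exact: sqr_ge0.
rewrite /E wD// ?wB// ?wZ//; last exact: bcont01B.
rewrite -/(E _ _) -/e0 -/(E _ _) -/e1 -/(E _ _) -/e2.
have -> : e2 - 2 * r * e1 + r * r * e0 = (e0 * e2 - e1 * e1) / e0.
  by rewrite /r; field; rewrite gt_eqF.
by rewrite pmulr_lge0 ?invr_gt0// subr_ge0.
Qed.

(** Besides bounding A in the nondecreasing case, this bounds |y|^2 times the shrinkage factor and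
    its derivative, as the growth conditions of Stein's identity require. *)
Lemma moment2_ub (K : R) : 0 <= c + 1 + K -> (forall k : R, 0 < k < 1 -> H k <= K) ->
  b * v * e2 <= (c + 1 + K) * e1.
Proof.
move=> K0 HK; apply: le_trans (ibp1 v0) _.
rewrite -wZ//; apply: wle.
- apply: bcont01M => //; apply: bcont01M; last exact: bg.
  by apply: bcont01D => //; exact: bcont01_cst.
- by apply: bcont01M => //; exact: bcont01_cst.
move=> k k01; rewrite mulrC; apply: ler_wpM2r; first by case/andP: k01 => /ltW.
apply: (@le_trans _ _ ((c + 1 + K) * g v k)).
  by apply: ler_wpM2r; [exact: g_ge0|rewrite lerD2l HK].
by rewrite ler_piMr// g_le1.
Qed.

Let EzH := E v (fun k => (1 - k) * H k).

Let E_f0 : E v (f0 v) = c * (e0 - e1) - b * e1 + EzH - v * (e1 - e2).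
Proof.
have bzH : bcont01 (fun k => (1 - k) * H k) by exact: bcont01M.
have t1 : bcont01 (fun k : R => c * (1 - k)) by apply: bcont01M => //; exact: bcont01_cst.
have t2 : bcont01 (fun k : R => b * k) by apply: bcont01M => //; exact: bcont01_cst.
have t3 : bcont01 (fun k : R => k * (1 - k)) by apply: bcont01M.
have t4 : bcont01 (fun k : R => v * (k * (1 - k))) by apply: bcont01M => //; exact: bcont01_cst.
rewrite /f0 /E wB//; last by apply: bcont01D => //; exact: bcont01B.
rewrite wD//; last exact: bcont01B.
rewrite wB// !wZ//.
rewrite [wint u v (fun k => 1 - k)]wB//.
have -> : wint u v (fun k => k * (1 - k)) = e1 - e2.
  by rewrite -wB//; apply: eq_wint => k _; rewrite mulrBr mulr1.
by [].
Qed.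

(** With r = e1/e0 and A = v e2/e1, dropping the nonnegative H-term leaves 2A - v r <= 2A - c + r (c
    + b - A), and [moment2_ub] gives 2A <= p + c. If A >= c + b the last term is nonpositive;
    otherwise r <= 1 yields at most A + b < c + 2b <= p. *)
Lemma dominance_nondecreasing (H1 : R) :
  (forall k : R, 0 < k < 1 -> 0 <= H k <= H1) -> c + 2 * b <= p ->
  2 * (c + 1 + H1) <= b * (p + c) ->
  2 * (v * e2 / e1) - v * e1 / e0 <= p.
Proof.
move=> HH cp bp.
have p0 := moment0_gt0; have p1 := moment1_gt0; have p2 := moment2_gt0.
have l1 := moment1_le.
have H10 : 0 <= H1.
  have /HH/andP[] : 0 < (2^-1 : R) < 1 by lra.
  exact: le_trans.
have cH : 0 <= c + 1 + H1 by have := c0; lra.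
have := moment2_ub cH (fun k k01 => proj2 (andP (HH k k01))).
have zH : 0 <= EzH.
  apply: (wint_ge0 u0) => k /[dup] k01 /HH/andP[Hk _]; rewrite mulr_ge0//.
  by case/andP: k01 => _ /ltW; rewrite subr_ge0.
have := ibp0_le v; rewrite E_f0.
set r := e1 / e0; set A := v * e2 / e1.
have r0 : 0 < r by rewrite divr_gt0.
have r1 : r <= 1 by rewrite ler_pdivrMr// mul1r.
have -> : v * e1 / e0 = v * r by rewrite mulrA.
have e1E : e1 = r * e0 by rewrite /r divfK// gt_eqF.
have ve2E : v * e2 = A * e1 by rewrite /A divfK// gt_eqF.
move=> i0; rewrite -mulrA ve2E mulrA ler_pM2r// => i1.
have i0' : c * (1 - r) - b * r - v * r + A * r <= 0.
  rewrite -(pmulr_lle0 _ p0).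
  have -> : (c * (1 - r) - b * r - v * r + A * r) * e0 =
    c * (e0 - e1) - b * e1 - v * (e1 - e2).
    transitivity (c * (e0 - e1) - b * e1 - v * e1 + v * e2); last by ring.
    by rewrite ve2E e1E; ring.
  lra.
have A2 : 2 * A <= p + c by rewrite -(ler_pM2l b0); lra.
have [AC|AC] := leP (c + b) A.
  have : 0 <= r * (A - (c + b)) by rewrite mulr_ge0 ?subr_ge0// ltW.
  lra.
have : r * (c + b - A) <= c + b - A by rewrite ler_piMl// subr_ge0 ltW.
lra.
Qed.

Lemma dominance_nonincreasing :
  (forall k : R, 0 < k < 1 -> H k <= 0) ->
  (forall k l : R, 0 < k -> k <= l -> l < 1 -> H l <= H k) ->
  0 < c -> c + 2 < p -> 2 * (c + 1) <= b * (p + c) ->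
  2 * (v * e2 / e1) - v * e1 / e0 <= p.
Proof.
move=> H0 Hmon cpos cp bp.
have p0 := moment0_gt0; have p1 := moment1_gt0; have p2 := moment2_gt0.
have l1 := moment1_le; have l2 := moment2_le.
pose N k := - H k.
have bN : bcont01 N by exact: bcont01N.
have bgv := bg v0.
have bNg : bcont01 (fun k => N k * g v k) by exact: bcont01M.
have bkg : bcont01 (fun k => k * g v k) by exact: bcont01M.
have bkNg : bcont01 (fun k => k * (N k * g v k)) by exact: bcont01M.
have bzN : bcont01 (fun k => (1 - k) * N k) by exact: bcont01M.
pose eg := E v (g v); pose eq := E v (fun k => k * g v k).
pose m0 := E v (fun k => N k * g v k); pose m1 := E v (fun k => k * (N k * g v k)).
pose ez := E v (fun k => (1 - k) * N k).
have EzHE : EzH = - ez.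
  by rewrite /ez /E -wintN//; apply: eq_wint => k _; rewrite /N mulrN opprK.
have N0 k : 0 < k < 1 -> 0 <= N k by move=> /H0; rewrite oppr_ge0.
have m00 : 0 <= m0.
  by apply: (wint_ge0 u0) => k k01; apply: mulr_ge0; [exact: N0|exact: g_ge0].
have m10 : 0 <= m1.
  apply: (wint_ge0 u0) => k k01; apply: mulr_ge0; first by case/andP: k01 => /ltW.
  by apply: mulr_ge0; [exact: N0|exact: g_ge0].
have ez0 : 0 <= ez.
  apply: (wint_ge0 u0) => k k01; apply: mulr_ge0; last exact: N0.
  by case/andP: k01 => _ /ltW; rewrite subr_ge0.
have eg0 : 0 <= eg by apply: (wint_ge0 u0) => k k01; exact: g_ge0.
have eg1 : eg <= e0 by apply: wle => // k _; exact: g_le1.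
have eq0 : 0 <= eq.
  apply: (wint_ge0 u0) => k k01; apply: mulr_ge0; last exact: g_ge0.
  by case/andP: k01 => /ltW.
have eq1 : eq <= e1.
  by apply: wle => // k /andP[k0 _]; rewrite ler_piMr ?g_le1// ltW.
have I1 : b * v * e2 <= (c + 1) * eq - m1.
  apply: le_trans (ibp1 v0) _; rewrite -wZ// -wB//; last first.
    by apply: bcont01M => //; exact: bcont01_cst.
  rewrite le_eqVlt; apply/orP; left; apply/eqP; apply: eq_wint => k _.
  by rewrite /N; ring.
have I0 : c * (e0 - e1) - b * e1 - ez - v * (e1 - e2) = 0.
  by rewrite -(ibp0_eq v cpos) E_f0 EzHE.
(* Chebyshev's association inequality for the nondecreasing functions [N] and [id] *)
have I2 : m0 * eq <= m1 * eg.
  have [eg00|egp] := eqVneq eg 0.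
    have -> : eq = 0.
      apply/eqP; rewrite eq_le eq0 andbT -eg00; apply: wle => // k k01.
      by case/andP: (k01) => k0 k1; rewrite ler_piMl ?g_ge0// ltW.
    by rewrite mulr0 mulr_ge0.
  have egpos : 0 < eg by rewrite lt_neqAle eq_sym egp.
  pose t := eq / eg.
  have t0 : 0 <= t by rewrite divr_ge0.
  (* t is the mean of k under the weight times g, so the K-terms integrate to 0 and integrating the
     pointwise inequality leaves m1 - t m0 >= 0. *)
  suff [K hK] : exists K, forall k, 0 < k < 1 -> 0 <= (N k - K) * (k - t).
    have := wint_ge0 u0 v (fun k k01 => mulr_ge0 (hK k k01) (g_ge0 v0 k01)).
    have -> : wint u v (fun k => (N k - K) * (k - t) * g v k) =
        m1 - t * m0 - (K * eq - K * t * eg).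
      rewrite -!wZ// -!wB//.
      - by apply: eq_wint => k _; ring.
      - by apply: bcont01B => //; apply: bcont01M => //; exact: bcont01_cst.
      - by apply: bcont01B; apply: bcont01M => //; exact: bcont01_cst.
      - by apply: bcont01M => //; exact: bcont01_cst.
      - by apply: bcont01M => //; exact: bcont01_cst.
      - by apply: bcont01M => //; exact: bcont01_cst.
    have -> : K * eq - K * t * eg = 0 by rewrite /t; field.
    rewrite subr0 subr_ge0 /t mulrAC ler_pdivrMr//.
    by rewrite mulrC.
  (* K = N(t) works by monotonicity when 0 < t < 1. Monotonicity of N is known only inside the
     interval, so t = 0 uses K = 0 and t >= 1 an upper bound of N. *)
  have [t1|t1] := ltP t 1.
    have [tz|tp] := eqVneq t 0.
      exists 0 => k k01; rewrite tz !subr0 mulr_ge0 ?N0//.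
      by case/andP: k01 => /ltW.
    have tpos : 0 < t by rewrite lt_neqAle eq_sym tp.
    exists (N t) => k /andP[k0 k1]; have [kt|tk] := leP k t.
      rewrite -mulrNN mulr_ge0// oppr_ge0 subr_le0//.
      by rewrite /N lerN2; exact: Hmon.
    rewrite mulr_ge0// subr_ge0; last exact: ltW.
    by rewrite /N lerN2; apply: Hmon => //; exact: ltW.
  have [_ [M NM]] := bN.
  exists M => k k01; rewrite -mulrNN mulr_ge0// oppr_ge0 subr_le0.
    exact: le_trans (ler_norm _) (NM k k01).
  by case/andP: k01 => _ /ltW/le_trans; apply.
(* As a function of 1 - k, g is concave with values 0 and 1 - exp(-v) at 0 and 1, so it lies above
   its chord. The proof combines, with weights 1 - k and k, the tangent bounds i1 and i2 for exp at
   -v (1-k). *)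
have I3 : ez * (1 - expR (- v)) <= m0.
  rewrite mulrC -wZ//; apply: wle => //; first by apply: bcont01M => //; exact: bcont01_cst.
  move=> k k01; rewrite mulrA [leLHS]mulrC; apply: ler_wpM2l; first exact: N0.
  case/andP: k01 => k0 k1; rewrite /g; set m := expR (- (v * (1 - k))).
  have m0' : 0 < m by exact: expR_gt0.
  have i1 : m * (1 - v * k) <= expR (- v).
    have -> : expR (- v) = m * expR (- (v * k)) by rewrite -expRD; congr expR; ring.
    by rewrite ler_pM2l//; exact: expR_ge1Dx.
  have i2 : m * (1 + v * (1 - k)) <= 1.
    have me : m * expR (v * (1 - k)) = 1 by rewrite -expRD addNr expR0.
    rewrite -[leRHS]me.
    by rewrite ler_pM2l//; exact: expR_ge1Dx.
  have : (1 - k) * (m * (1 - v * k)) <= (1 - k) * expR (- v).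
    by apply: ler_wpM2l => //; rewrite subr_ge0 ltW.
  have : k * (m * (1 + v * (1 - k))) <= k * 1 by apply: ler_wpM2l => //; exact: ltW.
  move=> j1 j2; lra.
set r := e1 / e0; set A := v * e2 / e1.
have r0 : 0 < r by rewrite divr_gt0.
have -> : v * e1 / e0 = v * r by rewrite mulrA.
have e1E : e1 = r * e0 by rewrite /r divfK// gt_eqF.
have ve2E : v * e2 = A * e1 by rewrite /A divfK// gt_eqF.
have Av : A <= v by rewrite /A ler_pdivrMr//; apply: ler_wpM2l.
(* If 2A <= p the goal is immediate; otherwise v >= A > p/2, which makes exp(-v) small. *)
have [Ap|Ap] := leP (2 * A) p.
  have : 0 <= v * r by rewrite mulr_ge0// ltW.
  lra.
pose q' := eq / e1.
have q'1 : q' <= 1 by rewrite ler_pdivrMr// mul1r.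
have eqE : eq = q' * e1 by rewrite /q' divfK// gt_eqF.
have J1 : m1 <= ((c + 1) * q' - b * A) * e1.
  suff <- : (c + 1) * eq - b * v * e2 = ((c + 1) * q' - b * A) * e1 by lra.
  by rewrite -(mulrA b) ve2E eqE; ring.
have bA0 : 0 < b * A by rewrite mulr_gt0//; have := c0; lra.
have q'0 : 0 < q'.
  have : 0 <= (c + 1) * q' - b * A by rewrite -(pmulr_lge0 _ p1); lra.
  move=> q0; have c1 : 0 < c + 1 by lra.
  by rewrite -(pmulr_rgt0 _ c1); lra.
pose X := c + 1 - b * A.
(* Chebyshev with eg <= e0 gives m0 q' <= ((c+1) q' - b A) e0; since q' <= 1, b A may be replaced by
   b A q' and q' cancelled. *)
have J2 : m0 <= X * e0.
  have h1 : m0 * (q' * e1) <= ((c + 1) * q' - b * A) * e1 * e0.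
    rewrite -eqE; apply: le_trans I2 _; apply: ler_pM => //.
  have h2 : m0 * q' <= ((c + 1) * q' - b * A) * e0.
    by rewrite -(ler_pM2r p1); lra.
  rewrite -(ler_pM2r q'0); apply: le_trans h2 _.
  have : 0 <= b * A * e0 * (1 - q').
    by apply: mulr_ge0; [apply: mulr_ge0; exact: ltW|rewrite subr_ge0].
  rewrite /X; lra.
have X0 : 0 <= X by rewrite -(pmulr_lge0 _ p0); lra.
pose x := ez / e0.
have x0 : 0 <= x by rewrite divr_ge0// ltW.
have ezE : ez = x * e0 by rewrite /x divfK// gt_eqF.
have J3 : x * (1 - expR (- v)) <= X.
  by rewrite -(ler_pM2r p0) mulrAC -ezE; exact: le_trans I3 J2.
have J0 : c * (1 - r) - b * r - x - v * r + A * r = 0.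
  apply: (mulIf (lt0r_neq0 p0)); rewrite mul0r.
  transitivity (c * (e0 - e1) - b * e1 - ez - v * e1 + v * e2); last by rewrite -[RHS]I0; ring.
  by rewrite ve2E ezE e1E; ring.
have r1 : r <= 1 by rewrite /r ler_pdivrMr// mul1r.
exact: (@dominance_arithmetic _ b c p v r A x).
Qed.
End moments.
End prior_weight.

(** * Risk of shrinkage estimators *)

Section shrinkage_risk.
Context {R : realType}.
Local Notation T := (measurableTypeR R).
Variables (p : nat) (phi dphi : R -> R) (C : R).
Hypothesis dphiE : forall w : R, is_derive w (1 : R) phi (dphi w).
Hypothesis cdphi : continuous dphi.
Hypothesis phi01 : forall w, 0 <= w -> 0 <= phi w <= 1.
Hypothesis wphi : forall w, 0 <= w -> w * phi w <= C.
Hypothesis wdphi : forall w, 0 <= w -> w * `|dphi w| <= C.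
Hypothesis Dle : forall w, 0 <= w ->
  w * phi w ^+ 2 - 2 * p%:R * phi w - 4 * w * dphi w <= 0.

Let delta (y : p.-tuple T) : p.-tuple T := scalet (1 - phi (sqnorm y)) y.

Let cphi : continuous phi.
Proof. by move=> w; exact: drv_continuous (dphiE w). Qed.

Let sqnorm_ge0 (y : p.-tuple T) : 0 <= sqnorm y.
Proof. by apply: sumr_ge0 => i _; exact: sqr_ge0. Qed.

Let msqnorm : measurable_fun [set: p.-tuple T] (@sqnorm R p).
Proof.
apply: measurable_sum => i; apply: measurable_funX; exact: measurable_tnth.
Qed.

Let mphi : measurable_fun [set: p.-tuple T] (fun y => phi (sqnorm y)).
Proof. by apply: (measurableT_comp _ msqnorm); exact: continuous_measurable_fun. Qed.

Let mdphi : measurable_fun [set: p.-tuple T] (fun y => dphi (sqnorm y)).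
Proof. by apply: (measurableT_comp _ msqnorm); exact: continuous_measurable_fun. Qed.

Let mt (i : 'I_p) : measurable_fun [set: p.-tuple T] (fun y => tnth y i : R).
Proof. exact: measurable_tnth. Qed.

Lemma shrinkage_estimator : estimator delta.
Proof.
apply/measurable_fun_tnthP => i.
rewrite (_ : _ \o _ = fun y => (1 - phi (sqnorm y)) * tnth y i).
  by apply: measurable_funM => //; apply: measurable_funB.
by apply/funext => y /=; rewrite tnth_mktuple.
Qed.

Let sq_le (y : p.-tuple T) i : tnth y i ^+ 2 <= sqnorm y.
Proof.
rewrite /sqnorm (bigD1 i)//= lerDl; apply: sumr_ge0 => j _; exact: sqr_ge0.
Qed.

Let rest (y : p.-tuple T) i : R := \sum_(j < p | j != i) tnth y j ^+ 2.

Let sqnorm_upd y i (t : R) : sqnorm (upd y i t) = t * t + rest y i.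
Proof.
rewrite /sqnorm (bigD1 i)//= tnth_mktuple eqxx -expr2; congr (_ + _).
by apply: eq_bigr => j /negbTE ji; rewrite tnth_mktuple ji.
Qed.

Let tnth_upd (y : p.-tuple T) i (t : R) : tnth (upd y i t) i = t.
Proof. by rewrite tnth_mktuple eqxx. Qed.

Section coordinate.
Variables (b : p.-tuple T) (i : 'I_p).

(** The squared error in coordinate i is (y_i - b_i) G + S. Stein's identity replaces the first term
    by [G'], the i-th partial derivative of G; summing over i gives the unbiased risk estimate. *)
Let G (y : p.-tuple T) : R := (tnth y i - tnth b i) - 2 * phi (sqnorm y) * tnth y i.
Let G' (y : p.-tuple T) : R := 1 - 2 * phi (sqnorm y) - 4 * dphi (sqnorm y) * tnth y i ^+ 2.
Let S (y : p.-tuple T) : R := phi (sqnorm y) ^+ 2 * tnth y i ^+ 2.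
(** One constant for the linear growth of [G] and the bound on [G'], since [stein_mvnormal] takes a
    single one. *)
Let K : R := 3 + 2 * `|tnth b i| + 4 * C.

Let C0 : 0 <= C.
Proof. by apply: le_trans (wphi (lexx 0)); rewrite mul0r. Qed.

Let mG : measurable_fun [set: p.-tuple T] G.
Proof.
apply: measurable_funB; first by apply: measurable_funB.
by apply: measurable_funM => //; apply: measurable_funM.
Qed.

Let mG' : measurable_fun [set: p.-tuple T] G'.
Proof.
apply: measurable_funB; first by apply: measurable_funB => //; apply: measurable_funM.
apply: measurable_funM; first by apply: measurable_funM.
exact: measurable_funX.
Qed.

Let mS : measurable_fun [set: p.-tuple T] S.
Proof. by apply: measurable_funM; exact: measurable_funX. Qed.

Let G_le y : `|G y| <= K * (1 + `|tnth y i - tnth b i|).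
Proof.
have /andP[p0 p1] := phi01 (sqnorm_ge0 y).
rewrite /G; apply: le_trans (ler_normB _ _) _.
rewrite 2!normrM (ger0_norm p0) (ger0_norm (_ : 0 <= 2))//.
have yb : `|tnth y i| <= `|tnth y i - tnth b i| + `|tnth b i|.
  by rewrite -{1}(subrK (tnth b i) (tnth y i)) ler_normD.
have : phi (sqnorm y) * `|tnth y i| <= `|tnth y i| by rewrite ler_piMl.
rewrite /K; have := normr_ge0 (tnth y i - tnth b i); have := normr_ge0 (tnth b i).
have := normr_ge0 (tnth y i).
move: yb; move: (`|tnth y i - _|) (`|tnth y i|) (`|tnth b i|) => A B D yb B0 D0 A0 h.
have : 0 <= D * A by exact: mulr_ge0.
have : 0 <= C * A by exact: mulr_ge0.
have := C0; lra.
Qed.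

Let G'_le y : `|G' y| <= K.
Proof.
have /andP[p0 p1] := phi01 (sqnorm_ge0 y).
have d1 : `|dphi (sqnorm y) * tnth y i ^+ 2| <= C.
  rewrite normrM mulrC (ger0_norm (sqr_ge0 _)).
  apply: le_trans (wdphi (sqnorm_ge0 y)).
  by apply: ler_wpM2r => //; exact: sq_le.
rewrite /G' /K -mulrA; have := normr_ge0 (tnth b i).
move: d1; rewrite !ler_norml => /andP[d1 d2] b0.
apply/andP; split; lra.
Qed.

Let S_le y : `|S y| <= C.
Proof.
have /andP[p0 p1] := phi01 (sqnorm_ge0 y).
rewrite /S ger0_norm; last by apply: mulr_ge0; exact: sqr_ge0.
apply: le_trans (wphi (sqnorm_ge0 y)); rewrite mulrC.
apply: ler_pM; [exact: sqr_ge0|exact: sqr_ge0|exact: sq_le|].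
by rewrite expr2 ler_piMr.
Qed.

Let bounded_integrable (f : p.-tuple T -> R) (M : R) : measurable_fun [set: p.-tuple T] f ->
  (forall y, `|f y| <= M) -> (mvnormal b).-integrable [set: p.-tuple T] (EFin \o f).
Proof.
move=> mf fM; apply: (@integrable_mvnormal_sqr _ _ _ i M) => // y.
apply: (le_trans (fM y)); rewrite ler_peMr//; first exact: le_trans (normr_ge0 _) (fM y).
by rewrite expr_ge1// lerDl.
Qed.

Let dGE y (t : R) : is_derive t (1 : R) (fun t => G (upd y i t)) (G' (upd y i t)).
Proof.
have -> : (fun t => G (upd y i t)) =
    fun t => (t + - tnth b i) + - (2 * phi (t * t + rest y i) * t).
  by apply/funext => s; rewrite /G tnth_upd sqnorm_upd.
rewrite /G' tnth_upd sqnorm_upd.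
have di := is_derive_id t (1 : R).
have dq := drv_add (drv_mul di di) (drv_cst t (rest y i)).
have dp := @drv_comp _ t phi (fun t : R => t * t + rest y i) _ _ (dphiE _) dq.
apply: (is_derive_eq (drv_add (drv_add di (drv_cst t (- tnth b i)))
  (drv_opp (drv_mul (drv_mul (drv_cst t 2) dp) di)))).
by rewrite /=; ring.
Qed.

Let cG'E y : continuous ((fun t => G' (upd y i t)) : R -> R).
Proof.
have -> : (fun t => G' (upd y i t)) =
    fun t => 1 - 2 * phi (t * t + rest y i) - 4 * dphi (t * t + rest y i) * (t * t).
  by apply/funext => s; rewrite /G' tnth_upd sqnorm_upd expr2.
move=> t; have ct : (fun t : R => t * t + rest y i) x @[x --> t] --> t * t + rest y i.
  by apply: cvgD; [apply: cvgM; exact: cvg_id|exact: cvg_cst].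
apply: cvgB; last first.
  apply: cvgM; last by apply: cvgM; exact: cvg_id.
  by apply: cvgM; [exact: cvg_cst|exact: (cvg_comp _ _ ct (@cdphi _))].
apply: cvgB; first exact: cvg_cst.
by apply: cvgM; [exact: cvg_cst|exact: (cvg_comp _ _ ct (@cphi _))].
Qed.

Lemma shrinkage_coordinate :
  [/\ (mvnormal b).-integrable [set: p.-tuple T]
        (fun y => ((tnth (delta y) i - tnth b i) ^+ 2)%:E),
      (mvnormal b).-integrable [set: p.-tuple T] (fun y => (G' y + S y)%:E) &
      (\int[mvnormal b]_y ((tnth (delta y) i - tnth b i) ^+ 2)%:E =
       \int[mvnormal b]_y (G' y + S y)%:E)%E].
Proof.
have iS := bounded_integrable mS S_le.
have iG' := bounded_integrable mG' G'_le.
have E1 : (fun y => ((tnth (delta y) i - tnth b i) ^+ 2)%:E) =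
    (fun y => ((tnth y i - tnth b i) * G y)%:E + (S y)%:E)%E.
  by apply/funext => y; rewrite -EFinD tnth_mktuple /G /S; congr EFin; ring.
have iG : (mvnormal b).-integrable [set: p.-tuple T]
    (fun y => ((tnth y i - tnth b i) * G y)%:E).
  apply: (@integrable_mvnormal_sqr _ _ _ i K).
    by apply: measurable_funM => //; apply: measurable_funB.
  move=> y; rewrite normrM; have := G_le y.
  have := normr_ge0 (tnth y i - tnth b i); have := normr_ge0 (G y).
  move: (`|tnth y i - tnth b i|) (`|G y|) => x z z0 x0 h.
  apply: (@le_trans _ _ (x * (K * (1 + x)))); first exact: ler_wpM2l.
  have K0 : 0 <= K by exact: le_trans (normr_ge0 _) (G'_le b).
  have := mulr_ge0 K0 x0; nra.
split.
- by rewrite E1; exact: integrableD.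
- by under eq_fun do rewrite EFinD; exact: integrableD.
- rewrite E1 integralD//.
  under [RHS]eq_integral do rewrite EFinD.
  rewrite integralD//; congr (_ + _)%E.
  exact: (stein_mvnormal mG mG' G_le G'_le dGE cG'E).
Qed.

End coordinate.

Lemma shrinkage_risk (b : p.-tuple T) : (risk delta b <= p%:R%:E)%E.
Proof.
pose F i (y : p.-tuple T) := ((tnth (delta y) i - tnth b i) ^+ 2)%:E.
pose Q i (y : p.-tuple T) := (1 - 2 * phi (sqnorm y) - 4 * dphi (sqnorm y) * tnth y i ^+ 2 +
  phi (sqnorm y) ^+ 2 * tnth y i ^+ 2)%:E.
have iF i : (mvnormal b).-integrable [set: p.-tuple T] (F i).
  by have [] := shrinkage_coordinate b i.
have iQ i : (mvnormal b).-integrable [set: p.-tuple T] (Q i).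
  by have [] := shrinkage_coordinate b i.
have FQ i : (\int[mvnormal b]_y F i y = \int[mvnormal b]_y Q i y)%E.
  by have [] := shrinkage_coordinate b i.
have -> : risk delta b = (\int[mvnormal b]_y (\sum_(i < p) F i y))%E.
  apply: eq_integral => y _; rewrite sumEFin; congr EFin.
  by apply: eq_bigr => i _; rewrite tnth_mktuple.
rewrite integral_sum// (eq_bigr _ (fun i _ => FQ i)) -integral_sum//.
apply: (@le_trans _ _ (\int[mvnormal b]__ (p%:R%:E : \bar R))%E); last first.
  rewrite integral_cst//= (_ : mvnormal b _ = 1%E) ?mule1//.
  exact: probability_setT.
apply: le_integral => //; first exact: integrable_sum.
  exact: finite_measure_integrable_cst.
move=> y _; rewrite sumEFin lee_fin.
rewrite big_split/= -mulr_sumr -/(sqnorm y) sumrB -mulr_sumr -/(sqnorm y).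
rewrite sumr_const card_ord -mulr_natl.
have := Dle (sqnorm_ge0 y); lra.
Qed.
End shrinkage_risk.

(** * Behaviour of h near the endpoints *)

Section one_sided_regularity.
Context {R : realType}.
Variable h : R -> R.
Hypothesis h_gt0 : forall k : R, 0 < k <= 1 -> 0 < h k.
Hypothesis h_C1 : continuously_differentiable_in `]0, 1] h.

Local Notation hp := (derive_in `]0, 1] h).

Let slope_cvg (k : R) : 0 < k <= 1 ->
  slope h k y @[y --> within `]0, 1]%classic k^'] --> hp k.
Proof. by move=> k01; have [+ _] := h_C1; apply; rewrite /= in_itv. Qed.

Let nbhs01 (k : R) : 0 < k < 1 -> \forall y \near k, 0 < y < 1.
Proof.
move=> /andP[k0 k1].
have h1 := lt_nbhsr k0; have h2 := lt_nbhsl k1.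
by apply: filterS2 h1 h2 => y -> ->.
Qed.

(** At interior points the relative slope limit is the two-sided one. Caratheodory's criterion
    applies to the slope function completed by its limit at k. *)
Lemma is_derive_derive_in (k : R) : 0 < k < 1 -> is_derive k (1 : R) h (hp k).
Proof.
move=> k01; have /andP[k0 k1] := k01.
have k01' : 0 < k <= 1 by rewrite k0 ltW.
apply/is_derive1_caratheodory.
exists (fun z => if z == k then hp k else slope h k z); split.
- move=> z; case: eqVneq => [->|zk]; first by rewrite !subrr mulr0.
  by rewrite /slope divfK// subr_eq0.
- move=> A; rewrite eqxx => hA.
  have sA : \forall z \near k, z != k -> `]0%R, 1%R]%classic z -> A (slope h k z).
    exact: slope_cvg k01' _ hA.
  apply: (@filterS2 _ (nbhs k) _ _ _ _ _ sA (nbhs01 k01)) => z zA /andP[z0 z1].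
  rewrite /=; case: (eqVneq z k) => [_|zk]; first exact: nbhs_singleton hA.
  by apply: zA; rewrite //= in_itv/= z0 ltW.
- by rewrite eqxx.
Qed.

Lemma continuous_derive_in (k : R) : 0 < k < 1 -> {for k, continuous hp}.
Proof.
move=> k01; have [_ ch] := h_C1.
have sub : `]0%R, 1%R[%classic `<=` (`]0%R, 1%R]%classic : set R).
  by move=> y; exact: subset_itv_oo_oc.
have := continuous_subspaceW sub ch.
rewrite continuous_open_subspace; last exact: interval_open.
by apply; rewrite inE/= in_itv.
Qed.

Lemma cvg_left1 : h k @[k --> (1 : R)^'-] --> h 1.
Proof.
have s1 : slope h 1 y @[y --> (1 : R)^'-] --> hp 1.
  have k1 : 0 < (1 : R) <= 1 by rewrite ltr01 lexx.
  move=> A hA.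
  have sA : \forall z \near (1 : R), z != 1 -> `]0%R, 1%R]%classic z -> A (slope h 1 z).
    exact: slope_cvg k1 _ hA.
  have z0 : \forall z \near (1 : R), 0 < z by exact: lt_nbhsr.
  apply: (@filterS2 _ (nbhs (1 : R)) _ _ _ (fun z => z < 1 -> A (slope h 1 z)) _ sA z0).
  by move=> z zA zp z1; apply: zA; rewrite ?lt_eqF//= in_itv/= zp ltW.
have : h 1 + slope h 1 y * (y - 1) @[y --> (1 : R)^'-] --> h 1 + hp 1 * (1 - 1).
  apply: cvgD; first exact: cvg_cst.
  apply: cvgM => //; apply: cvg_at_left_filter.
  by apply: cvgB; [exact: cvg_id|exact: cvg_cst].
rewrite subrr mulr0 addr0; apply: cvg_trans.
apply: near_eq_cvg; near=> y.
have y1 : y < 1 by near: y; exact: nbhs_left_lt.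
by rewrite /slope divfK ?subr_eq0 ?lt_eqF// addrC subrK.
Unshelve. all: by end_near. Qed.

(** The sign of s + H(k) decides the monotonicity of k^s h(k), which is how bounds on H become
    bounds on h. *)
Lemma is_derive_powR_mul (s k : R) : 0 < k < 1 ->
  is_derive k (1 : R) (fun k => k `^ s * h k) (k `^ (s - 1) * h k * (s + k * hp k / h k)).
Proof.
move=> k01; have /andP[k0 k1] := k01.
have hk : 0 < h k by apply: h_gt0; rewrite k0 ltW.
apply: (is_derive_eq (drv_mul (drv_powR s k0 (is_derive_id k (1 : R))) (is_derive_derive_in k01))).
by rewrite -(powR_mulB1 s k0)/=; field; rewrite gt_eqF.
Qed.

Lemma powR_mul_nondecreasing (s x y : R) : 0 < x -> x <= y -> y < 1 ->
  (forall k : R, x <= k <= y -> 0 <= s + k * hp k / h k) ->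
  x `^ s * h x <= y `^ s * h y.
Proof.
move=> x0; rewrite le_eqVlt => /predU1P[->//|xy] y1 hs.
have dF (k : R) : 0 < k < 1 -> is_derive k (1 : R) (fun k => k `^ s * h k)
    (k `^ (s - 1) * h k * (s + k * hp k / h k)).
  exact: is_derive_powR_mul.
have [] := @MVT _ (fun k => k `^ s * h k) (fun k => k `^ (s - 1) * h k * (s + k * hp k / h k)) _ _ xy.
- move=> k; rewrite in_itv/= => /andP[xk ky]; apply: dF.
  by rewrite (lt_trans x0 xk) (lt_trans ky y1).
- apply: continuous_in_subspaceT => k /set_mem/=; rewrite in_itv/= => /andP[xk ky].
  apply: (drv_continuous (dF k _)).
  by rewrite (lt_le_trans x0 xk) (le_lt_trans ky y1).
move=> k; rewrite in_itv/= => /andP[xk ky] e.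
rewrite -subr_ge0 e mulr_ge0 ?subr_ge0 ?(ltW xy)//.
have k0 := lt_trans x0 xk; have k1 := lt_trans ky y1.
apply: mulr_ge0; last by apply: hs; rewrite !ltW.
by rewrite mulr_ge0 ?powR_ge0// ltW// h_gt0// k0 ltW.
Qed.

Lemma powR_mul_nonincreasing (s x y : R) : 0 < x -> x <= y -> y < 1 ->
  (forall k : R, x <= k <= y -> s + k * hp k / h k <= 0) ->
  y `^ s * h y <= x `^ s * h x.
Proof.
move=> x0; rewrite le_eqVlt => /predU1P[->//|xy] y1 hs.
have dF (k : R) : 0 < k < 1 -> is_derive k (1 : R) (fun k => k `^ s * h k)
    (k `^ (s - 1) * h k * (s + k * hp k / h k)).
  exact: is_derive_powR_mul.
have [] := @MVT _ (fun k => k `^ s * h k) (fun k => k `^ (s - 1) * h k * (s + k * hp k / h k)) _ _ xy.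
- move=> k; rewrite in_itv/= => /andP[xk ky]; apply: dF.
  by rewrite (lt_trans x0 xk) (lt_trans ky y1).
- apply: continuous_in_subspaceT => k /set_mem/=; rewrite in_itv/= => /andP[xk ky].
  apply: (drv_continuous (dF k _)).
  by rewrite (lt_le_trans x0 xk) (le_lt_trans ky y1).
move=> k; rewrite in_itv/= => /andP[xk ky] e.
rewrite -subr_le0 e mulr_le0_ge0 ?subr_ge0 ?(ltW xy)//.
have k0 := lt_trans x0 xk; have k1 := lt_trans ky y1.
apply: mulr_ge0_le0; last by apply: hs; rewrite !ltW.
by rewrite mulr_ge0 ?powR_ge0// ltW// h_gt0// k0 ltW.
Qed.

End one_sided_regularity.

Section integrable_powers.
Context {R : realType}.
Local Notation mu := (@lebesgue_measure R).

Let pow1 (e : R) : 1 `^ e = 1 :> R.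
Proof. by rewrite powR1. Qed.

(** The exact value matters later: it is unbounded as e tends to 0. *)
Lemma powR_FTC01 (e : R) : 0 < e ->
  mu.-integrable `]0, 1[ (fun k => (k `^ (e - 1))%:E) /\
  \int[mu]_(k in `]0, 1[) (k `^ (e - 1)) = e^-1.
Proof.
move=> e0.
have dF (k : R) : 0 < k < 1 -> is_derive k (1 : R) (fun k => e^-1 * k `^ e) (k `^ (e - 1)).
  move=> /andP[k0 _].
  apply: (is_derive_eq (drv_mul (drv_cst k e^-1) (drv_powR e k0 (is_derive_id k (1 : R))))).
  by rewrite /=; field; rewrite gt_eqF.
have cf (k : R) : 0 < k < 1 -> {for k, continuous (fun k => k `^ (e - 1))}.
  by move=> /andP[k0 _]; exact: (drv_continuous (drv_powR (e - 1) k0 (is_derive_id k (1 : R)))).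
have i : mu.-integrable `]0, 1[ (EFin \o (fun k => k `^ (e - 1))).
  apply: (integrable_FTC01 dF cf (C := e^-1)) => k /andP[k0 k1].
    exact: powR_ge0.
  have e0' : 0 <= e^-1 by rewrite invr_ge0 ltW.
  rewrite ger0_norm ?mulr_ge0 ?powR_ge0//.
  apply: ler_piMr => //; rewrite -[leRHS](pow1 e).
  by apply: ge0_ler_powR; rewrite ?nnegrE; lra.
split => //.
rewrite -[RHS]subr0; apply: (FTC01 dF cf i).
  rewrite -[X in _ --> X](mulr0 e^-1); apply: cvgM; first exact: cvg_cst.
  exact: powR_cvg0.
rewrite -[X in _ --> X](mulr1 e^-1); apply: cvgM; first exact: cvg_cst.
rewrite -[X in _ --> X](pow1 e); apply: cvg_at_left_filter.
exact: (drv_continuous (drv_powR e ltr01 (is_derive_id (1 : R) (1 : R)))).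
Qed.

Lemma integrable_powR1B (b : R) : 0 < b ->
  mu.-integrable `]0, 1[ (fun k => ((1 - k) `^ (b - 1))%:E).
Proof.
move=> b0.
have dm (k : R) : is_derive k (1 : R) (fun k => 1 - k) (-1).
  by apply: (is_derive_eq (drv_add (drv_cst k 1) (drv_opp (is_derive_id k 1)))); rewrite add0r.
have dF (k : R) : 0 < k < 1 -> is_derive k (1 : R) (fun k => - b^-1 * (1 - k) `^ b) ((1 - k) `^ (b - 1)).
  move=> /andP[_ k1]; have z0 : 0 < 1 - k by rewrite subr_gt0.
  apply: (is_derive_eq (drv_mul (drv_cst k (- b^-1)) (@drv_powR _ _ (fun k => 1 - k) _ b z0 (dm k)))).
  by rewrite /=; field; rewrite gt_eqF.
have cf (k : R) : 0 < k < 1 -> {for k, continuous (fun k : R => (1 - k) `^ (b - 1))}.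
  move=> /andP[_ k1]; have z0 : 0 < 1 - k by rewrite subr_gt0.
  exact: (drv_continuous (@drv_powR _ _ (fun k => 1 - k) _ (b - 1) z0 (dm k))).
apply: (integrable_FTC01 dF cf (C := b^-1)) => k /andP[k0 k1].
  exact: powR_ge0.
have b0' : 0 <= b^-1 by rewrite invr_ge0 ltW.
rewrite normrM normrN !ger0_norm ?powR_ge0//.
apply: ler_piMr => //; rewrite -[leRHS](pow1 b).
by apply: ge0_ler_powR; rewrite ?nnegrE; lra.
Qed.
End integrable_powers.

(** * Growth of h at 0 and integrability of the prior weight *)

Section prior_regularity.
Context {R : realType}.
Local Notation mu := (@lebesgue_measure R).
Variables (h : R -> R) (B : R).
Hypothesis h_gt0 : forall k : R, 0 < k <= 1 -> 0 < h k.
Hypothesis h_C1 : continuously_differentiable_in `]0, 1] h.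
Local Notation hp := (derive_in `]0, 1] h).
Hypothesis h_lim : k * hp k / h k @[k --> (0 : R)^'+] --> (0 : R).
Hypothesis HB : forall k : R, 0 < k < 1 -> `|k * hp k / h k| <= B.

Let B0 : 0 <= B.
Proof. by apply: le_trans (normr_ge0 _) (HB (_ : 0 < 2^-1 < 1)); lra. Qed.

(** Near 0, |H| < e, so k^e h(k) increases up to some t. Beyond t, H <= B makes k^(-B) h(k)
    nonincreasing, and k^e <= k^(-B) on (0,1). *)
Lemma powR_mul_bounded (e : R) : 0 < e ->
  exists M, forall k : R, 0 < k < 1 -> k `^ e * h k <= M.
Proof.
move=> e0.
have : \forall k \near (0 : R)^'+, `|k * hp k / h k| < e.
  by apply: (cvgr0_norm_lt _ h_lim).
move=> [d /= d0 dH].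
pose t := Num.min d 1 / 2.
have td : 0 < t < d.
  by rewrite /t; case: (leP d 1) => dd; lra.
have t1 : t < 1 by rewrite /t; case: (leP d 1) => dd; lra.
have t01 : 0 < t <= 1 by lra.
have ht := h_gt0 t01.
exists (Num.max (t `^ e * h t) (t `^ (- B) * h t)) => k /andP[k0 k1].
rewrite le_max; have [kt|tk] := leP k t; apply/orP; [left|right].
  apply: (powR_mul_nondecreasing h_gt0 h_C1) => // x /andP[kx xt].
  have := dH x; rewrite /= sub0r normrN gtr0_norm; last lra.
  move=> /(_ _ _) h1; have : `|x * hp x / h x| < e by apply: h1; lra.
  by rewrite ltr_norml; lra.
have : k `^ (- B) * h k <= t `^ (- B) * h t.
  apply: (powR_mul_nonincreasing h_gt0 h_C1); rewrite ?ltW//; first by case/andP: td.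
  move=> x /andP[tx xk]; have := HB (_ : 0 < x < 1); rewrite ler_norml => /(_ _)/andP[].
    lra.
  lra.
apply: le_trans; apply: ler_wpM2r; first by rewrite ltW// h_gt0// k0 ltW.
by apply: ger_powR; [rewrite k0 ltW|have := B0; lra].
Qed.

Lemma powR_mul_cvg0 (e : R) : 0 < e -> k `^ e * h k @[k --> (0 : R)^'+] --> (0 : R).
Proof.
move=> e0; have e2 : 0 < e / 2 by lra.
have [M hM] := powR_mul_bounded e2.
apply/norm_cvg0P.
apply: (@squeeze_cvgr _ _ _ _ (fun=> 0) (fun k => k `^ (e / 2) * M)).
- near=> k.
  have k01 : 0 < k < 1.
    apply/andP; split; near: k; first exact: nbhs_right_gt.
    by apply: nbhs_right_lt.
  case/andP: (k01) => k0 k1; have hk : 0 < h k by rewrite h_gt0// k0 ltW.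
  rewrite normr_ge0 ger0_norm/=; last by apply: mulr_ge0; [exact: powR_ge0|exact: ltW].
  rewrite {1}(splitr e) powRD ?(gt_eqF k0) ?implybT// -mulrA.
  by apply: ler_wpM2l; [exact: powR_ge0|exact: hM].
- exact: cvg_cst.
- rewrite -[X in _ --> X](mul0r M); apply: cvgM; last exact: cvg_cst.
  exact: powR_cvg0.
Unshelve. all: by end_near. Qed.

(** Each endpoint has one singular factor: below 1/2 the power of 1 - k is at most 2, above 1/2 the
    factor k^(c-1) h(k) is bounded. At 0 with c > 0, half of the exponent c absorbs h and the other
    half keeps the power integrable. *)
Lemma integrable_prior_weight (c b : R) : 0 <= c -> 0 < b -> b < 1 ->
  (c = 0 -> mu.-integrable `]0, 1[ (fun k => (k^-1 * h k)%:E)) ->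
  mu.-integrable `]0, 1[ (EFin \o (fun k => k `^ (c - 1) * (1 - k) `^ (b - 1) * h k)).
Proof.
move=> c0 b0 b1 hc.
have ch (k : R) : 0 < k < 1 -> {for k, continuous h}.
  by move=> k01; exact: drv_continuous (is_derive_derive_in h_C1 k01).
have dm (k : R) : is_derive k (1 : R) (fun k => 1 - k) (-1).
  by apply: (is_derive_eq (drv_add (drv_cst k 1) (drv_opp (is_derive_id k 1)))); rewrite add0r.
have cz (e k : R) : 0 < k < 1 -> {for k, continuous (fun k : R => (1 - k) `^ e)}.
  move=> /andP[_ k1]; have z0 : 0 < 1 - k by rewrite subr_gt0.
  exact: (drv_continuous (@drv_powR _ _ (fun k => 1 - k) _ e z0 (dm k))).
have cp (e k : R) : 0 < k < 1 -> {for k, continuous (fun k : R => k `^ e)}.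
  by move=> /andP[k0 _]; exact: (drv_continuous (drv_powR e k0 (is_derive_id k (1 : R)))).
have md : measurable (`]0, 1[%classic : set (measurableTypeR R)) by exact: measurable_itv.
have ic : mu.-integrable `]0, 1[ (fun k => (k `^ (c - 1) * h k)%:E).
  move: c0; rewrite le_eqVlt => /predU1P[c0|c0].
    apply: eq_integrable (hc (esym c0)) => //.
    move=> k /set_mem/=; rewrite in_itv/= => /andP[k0 _].
    by rewrite -c0 sub0r powR_inv1// ltW.
  have c2 : 0 < c / 2 by lra.
  have [M hM] := powR_mul_bounded c2; have [iM _] := powR_FTC01 c2.
  apply: (@le_integrable _ _ _ mu `]0, 1[ md _ (fun k => (M * k `^ (c / 2 - 1))%:E)).
  - apply/measurable_EFinP; apply: measurable_continuous01 => k k01.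
    by apply: cvgM; [exact: cp|exact: ch].
  - move=> k /=; rewrite in_itv/= => k01; have /andP[k0 k1] := k01.
    rewrite lee_fin; apply: le_trans (ler_norm _).
    have hk : 0 < h k by apply: h_gt0; rewrite k0 ltW.
    rewrite ger0_norm; last by apply: mulr_ge0; [exact: powR_ge0|exact: ltW].
    have -> : c - 1 = c / 2 + (c / 2 - 1) by field.
    rewrite powRD ?(gt_eqF k0) ?implybT// mulrAC.
    by apply: ler_wpM2r; [exact: powR_ge0|exact: hM].
  - exact: (integrableZl _ M iM).
have [M hM] : exists M, forall k : R, 2^-1 <= k < 1 -> k `^ (c - 1) * h k <= M.
  have [M hM] := powR_mul_bounded (ltr01 : 0 < (1 : R)).
  exists (2^-1 `^ (- 2) * M) => k /andP[k2 k1].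
  have k0 : 0 < k by apply: lt_le_trans k2.
  have hk : 0 < h k by apply: h_gt0; rewrite k0 ltW.
  (* One power of k bounds h; the rest satisfies k^(c-2) <= k^(-2) <= (1/2)^(-2) because c >= 0 and
     k >= 1/2. *)
  have -> : c - 1 = 1 + (c - 2) by ring.
  rewrite powRD ?(gt_eqF k0) ?implybT// mulrAC mulrC.
  apply: ler_pM; rewrite ?powR_ge0//; last by apply: hM; rewrite k0.
    by apply: mulr_ge0; [exact: powR_ge0|exact: ltW].
  apply: (@le_trans _ _ (k `^ (- 2))).
    by apply: ger_powR; [rewrite k0 ltW|lra].
  rewrite !powRN lef_pV2 ?posrE ?powR_gt0//.
  by apply: ge0_ler_powR; rewrite ?nnegrE; lra.
have ib := integrable_powR1B b0.
have M0 : 0 <= M.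
  apply: le_trans (hM 2^-1 _); last by lra.
  by apply: mulr_ge0; [exact: powR_ge0|rewrite ltW// h_gt0//; lra].
apply: (@le_integrable _ _ _ mu `]0, 1[ md _
  (fun k => (2 * (k `^ (c - 1) * h k))%:E + (M * (1 - k) `^ (b - 1))%:E)%E).
- apply/measurable_EFinP; apply: measurable_continuous01 => k k01.
  by apply: cvgM; [apply: cvgM; [exact: cp|exact: cz]|exact: ch].
- move=> k /=; rewrite in_itv/= => k01; have /andP[k0 k1] := k01.
  have hk : 0 < h k by apply: h_gt0; rewrite k0 ltW.
  have z0 : 0 < 1 - k by rewrite subr_gt0.
  have p1 := powR_ge0 k (c - 1); have p2 := powR_ge0 (1 - k) (b - 1).
  have q1 : 0 <= k `^ (c - 1) * h k by apply: mulr_ge0 => //; exact: ltW.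
  rewrite lee_fin; apply: le_trans (ler_norm _).
  rewrite ger0_norm; last by rewrite mulrAC; exact: mulr_ge0.
  rewrite mulrAC; have [k2|k2] := leP 2^-1 k.
    have : k `^ (c - 1) * h k * (1 - k) `^ (b - 1) <= M * (1 - k) `^ (b - 1).
      by apply: ler_wpM2r => //; apply: hM; rewrite k2.
    lra.
  have z2 : (1 - k) `^ (b - 1) <= 2.
    apply: (@le_trans _ _ ((1 - k) `^ (- 1))).
      by apply: ger_powR; lra.
    rewrite powR_inv1; last exact: ltW.
    by rewrite -[leRHS]invrK lef_pV2 ?posrE ?invr_gt0//; lra.
  have : k `^ (c - 1) * h k * (1 - k) `^ (b - 1) <= k `^ (c - 1) * h k * 2 by apply: ler_wpM2l.
  have : 0 <= M * (1 - k) `^ (b - 1) by exact: mulr_ge0.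
  lra.
- by apply: integrableD => //; [exact: (integrableZl _ 2 ic)|exact: (integrableZl _ M ib)].
Qed.

(* k^(e-1) has integral 1/e, unbounded as e -> 0 *)
Lemma integrable_inv_nonincreasing_false :
  mu.-integrable `]0, 1[ (fun k => (k^-1 * h k)%:E) ->
  ~ (forall k : R, 0 < k < 1 -> k * hp k / h k <= 0).
Proof.
move=> ih H0.
have h1 : 0 < h 1 by apply: h_gt0; rewrite ltr01 lexx.
have hge (k : R) : 0 < k < 1 -> h 1 <= h k.
  move=> /andP[k0 k1].
  apply: (ler_cvg_to (cvg_left1 h_C1) (cvg_cst (h k))).
  near=> l.
  have kl : k <= l by near: l; exact: nbhs_left_ge.
  have l1 : l < 1 by near: l; exact: nbhs_left_lt.
  have := @powR_mul_nonincreasing _ _ h_gt0 h_C1 0 _ _ k0 kl l1.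
  rewrite !powRr0 !mul1r; apply => x /andP[kx xl]; rewrite add0r; apply: H0.
  by rewrite (lt_le_trans k0 kx) (le_lt_trans xl l1).
pose I := \int[mu]_(k in `]0, 1[) (k^-1 * h k).
have md : measurable (`]0, 1[%classic : set (measurableTypeR R)) by exact: measurable_itv.
have hI (e : R) : 0 < e -> h 1 / e <= I.
  move=> e0; have [ie <-] := powR_FTC01 e0.
  have kinv (k : R) : 0 < k < 1 -> k `^ (e - 1) <= k^-1.
    move=> /andP[k0 k1]; have <- : k `^ (-1) = k^-1 by rewrite powR_inv1// ltW.
    by apply: ger_powR; [rewrite k0 ltW|lra].
  rewrite -RintegralZl//; apply: le_Rintegral => //.
    by apply: (integrableZl _ (h 1) ie).
  move=> k; rewrite /= in_itv/= => k01; have /andP[k0 k1] := k01.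
  rewrite mulrC; apply: ler_pM; rewrite ?powR_ge0//; [exact: ltW|exact: kinv|exact: hge].
have I0 : 0 < I by apply: lt_le_trans (hI 1 ltr01); rewrite divr1.
have I1 : 0 < I + 1 by rewrite addr_gt0.
(* At e = h(1)/(I + 1) the bound reads I + 1 <= I. *)
have := hI _ (divr_gt0 h1 I1); rewrite invf_div mulrCA mulfV ?gt_eqF//.
lra.
Unshelve. all: by end_near. Qed.
End prior_regularity.

(** * Minimaxity *)

Section bayes_minimax.
Context {R : realType}.
Local Notation mu := (@lebesgue_measure R).
Variables (p : nat) (a b B : R) (h : R -> R).
Local Notation c := (p%:R / 2 + a).
Local Notation hp := (derive_in `]0, 1] h).
Hypothesis p_gt0 : (0 < p)%N.
Hypothesis c0 : 0 <= c.
Hypothesis b0 : 0 < b.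
Hypothesis b1 : b < 1.
Hypothesis h_gt0 : forall k : R, 0 < k <= 1 -> 0 < h k.
Hypothesis h_C1 : continuously_differentiable_in `]0, 1] h.
Hypothesis h_lim : k * hp k / h k @[k --> (0 : R)^'+] --> (0 : R).
Hypothesis h_int : c = 0 -> mu.-integrable `]0, 1[ (fun k => (k^-1 * h k)%:E).
Hypothesis HB : forall k : R, 0 < k < 1 -> `|k * hp k / h k| <= B.

Let u (k : R) := k `^ (c - 1) * (1 - k) `^ (b - 1) * h k.

Let h0 (k : R) : 0 < k < 1 -> 0 < h k.
Proof. by move=> /andP[k0 k1]; rewrite h_gt0// k0 ltW. Qed.

Let dh := is_derive_derive_in h_C1.

Let chp := continuous_derive_in h_C1.

Let h_at0 := powR_mul_cvg0 h_gt0 h_C1 h_lim HB.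

Let h_at1 : exists h1 : R, h k @[k --> (1 : R)^'-] --> h1.
Proof. by exists (h 1); exact: cvg_left1. Qed.

Let intu : mu.-integrable `]0, 1[ (EFin \o u).
Proof. exact: (integrable_prior_weight h_gt0 h_C1 h_lim HB). Qed.

Let e0 (v : R) := wint u v (fun=> 1).
Let e1 (v : R) := wint u v (fun k => k).
Let e2 (v : R) := wint u v (fun k => k * k).

Hypothesis dominance : forall v, 0 <= v ->
  2 * (v * e2 v / e1 v) - v * e1 v / e0 v <= p%:R.

Let e0_gt0 v : 0 < e0 v.
Proof. exact: (moment0_gt0 h0 dh intu). Qed.

Let e1_gt0 v : 0 < e1 v.
Proof. exact: (moment1_gt0 h0 dh intu). Qed.

Let phi (w : R) := e1 (w / 2) / e0 (w / 2).
Let dphi (w : R) := - 2^-1 * (e2 (w / 2) / e0 (w / 2) - phi w ^+ 2).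

Let u_gt0 (k : R) : 0 < k < 1 -> 0 < u k.
Proof.
move=> k01; rewrite /u mulr_gt0 ?h0//; case/andP: k01 => k0 k1.
by rewrite mulr_gt0// powR_gt0// subr_gt0.
Qed.

Let cu (k : R) : 0 < k < 1 -> {for k, continuous u}.
Proof.
move=> k01; have /andP[k0 k1] := k01; have z0 : 0 < 1 - k by rewrite subr_gt0.
have dm : is_derive k (1 : R) (fun k => 1 - k) (-1).
  by apply: (is_derive_eq (drv_add (drv_cst k 1) (drv_opp (is_derive_id k 1)))); rewrite add0r.
apply: cvgM; last exact: drv_continuous (dh k01).
apply: cvgM; first exact: drv_continuous (drv_powR (c - 1) k0 (is_derive_id k 1)).
exact: (drv_continuous (@drv_powR _ _ (fun k => 1 - k) _ (b - 1) z0 dm)).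
Qed.

Let bk : bcont01 (fun k : R => k) := bcont01_id.

Let de0 (w : R) : is_derive w (1 : R) (fun w => e0 (w / 2)) (- (2^-1 * e1 (w / 2))).
Proof.
apply: (is_derive_eq (der_wint u_gt0 cu intu w (bcont01_cst 1))).
by congr (- (_ * _)); apply: eq_wint => k _; rewrite mulr1.
Qed.

Let de1 (w : R) : is_derive w (1 : R) (fun w => e1 (w / 2)) (- (2^-1 * e2 (w / 2))).
Proof. exact: (der_wint u_gt0 cu intu w bk). Qed.

Let dphiE (w : R) : is_derive w (1 : R) phi (dphi w).
Proof.
have n0 : e0 (w / 2) != 0 by rewrite gt_eqF.
apply: (is_derive_eq (drv_mul (de1 w) (@drv_inv _ _ (fun w => e0 (w / 2)) _ n0 (de0 w)))).
by rewrite /dphi /phi; field.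
Qed.

Let cdphi : continuous dphi.
Proof.
move=> w; have n0 : e0 (w / 2) != 0 by rewrite gt_eqF.
apply: cvgM; first exact: cvg_cst.
apply: cvgB.
  apply: cvgM; first exact: (continuous_wint u_gt0 cu intu (bcont01M bk bk)).
  by apply: cvgV => //; exact: drv_continuous (de0 w).
by apply: cvgM; exact: drv_continuous (dphiE w).
Qed.

Let K : R := c + 1 + B.

Let B0 : 0 <= B.
Proof. by apply: le_trans (normr_ge0 _) (HB (_ : 0 < 2^-1 < 1)); lra. Qed.

(** The witness is s = e2/e1, in terms of which phi' = -(1/2) phi (s - phi). So 0 <= phi <= s and
    the bound on w s control both w phi and w phi', while the last item is the dominance
    inequality. *)
Let phi_facts (w : R) : 0 <= w -> exists s,
  [/\ e2 (w / 2) / e0 (w / 2) = s * phi w, 0 < phi w <= 1, phi w <= s,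
      w / 2 * s <= K / b & 2 * (w / 2 * s) - w / 2 * phi w <= p%:R].
Proof.
move=> w0; set v := w / 2; have v0 : 0 <= v by rewrite /v; lra.
have p0 := e0_gt0 v; have p1 := e1_gt0 v.
exists (e2 v / e1 v); split.
- by rewrite /phi -/v; field; rewrite !gt_eqF.
- rewrite divr_gt0//= ler_pdivrMr// mul1r; exact: (moment1_le h0 dh intu).
- rewrite ler_pdivrMr// mulrAC ler_pdivlMr// [leRHS]mulrC.
  exact: (moment1_sqr h0 dh intu).
- have ub : b * v * e2 v <= K * e1 v.
    apply: (moment2_ub c0 b0 b1 h0 dh chp HB h_at0 h_at1 intu v0).
      by have := B0; have := c0; lra.
    by move=> k /HB; rewrite ler_norml => /andP[].
  rewrite mulrA ler_pdivrMr// (_ : K / b * e1 v = K * e1 v / b); last by rewrite mulrAC.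
  by rewrite ler_pdivlMr//; lra.
- by rewrite !mulrA; have := dominance v0; rewrite !mulrA.
Qed.

Lemma bayes_estimator_shrinkage :
  bayes_estimator (prior a b h) = fun y : p.-tuple R => scalet (1 - phi (sqnorm y)) y.
Proof.
have pw (k s t : R) : 0 < k -> k `^ (s + t) = k `^ s * k `^ t.
  by move=> k0; rewrite powRD ?(gt_eqF k0) ?implybT.
have kE (k w : R) : k * w / 2 = w / 2 * k by ring.
have cE : c - 1 = p%:R / 2 + (a - 1) by ring.
have m0 w : bayes_integral w (prior a b h) (p%:R / 2) = e0 (w / 2).
  apply: eq_Rintegral => k /set_mem; rewrite /= in_itv => /andP[k0 _].
  by rewrite /prior /u cE (pw _ _ (a - 1) k0) (kE k w); ring.
have m1 w : bayes_integral w (prior a b h) (p%:R / 2 + 1) = e1 (w / 2).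
  apply: eq_Rintegral => k /set_mem; rewrite /= in_itv => /andP[k0 _].
  rewrite /prior /u cE (pw _ _ (a - 1) k0) (pw _ _ 1 k0) (kE k w) powRr1 ?ltW//.
  by ring.
by apply/funext => y; rewrite /bayes_estimator m0 m1.
Qed.

Lemma bayes_estimator_minimax : minimax (@bayes_estimator R p (prior a b h)).
Proof.
rewrite bayes_estimator_shrinkage.
have phi01 w : 0 <= w -> 0 <= phi w <= 1.
  by move=> /phi_facts[s [_ /andP[/ltW-> ->]]].
have wphi w : 0 <= w -> w * phi w <= 2 * (K / b).
  move=> w0; have [s [_ _ ps sK _]] := phi_facts w0.
  have : w * phi w <= w * s by exact: ler_wpM2l.
  lra.
have wdphi w : 0 <= w -> w * `|dphi w| <= 2 * (K / b).
  move=> w0; have [s [sE /andP[p0 p1] ps sK _]] := phi_facts w0.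
  have q0 : 0 <= e2 (w / 2) / e0 (w / 2) - phi w ^+ 2.
    rewrite sE expr2 -mulrBl; apply: mulr_ge0; last exact: ltW.
    by rewrite subr_ge0.
  rewrite /dphi normrM normrN !ger0_norm// sE.
  have ss : s * phi w <= s by rewrite ler_piMr// (le_trans (ltW p0)).
  have : w * (s * phi w) <= w * s by exact: ler_wpM2l.
  have : 0 <= w * phi w ^+ 2 by apply: mulr_ge0 => //; exact: sqr_ge0.
  have : 0 <= w * s by apply: mulr_ge0 => //; exact: le_trans (ltW p0) ps.
  lra.
have Dle w : 0 <= w -> w * phi w ^+ 2 - 2 * p%:R * phi w - 4 * w * dphi w <= 0.
  move=> w0; have [s [sE /andP[p0 p1] ps sK dom]] := phi_facts w0.
  rewrite /dphi sE.
  have : phi w * (2 * (w / 2 * s) - w / 2 * phi w - p%:R) <= 0.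
    by rewrite pmulr_rle0// subr_le0.
  lra.
split.
  exact: (shrinkage_estimator dphiE).
move=> delta' md'.
apply: (@le_trans _ _ p%:R%:E); last exact: risk_lower_bound.
apply: ge_ereal_sup => _ [beta _ <-].
exact: (shrinkage_risk dphiE cdphi phi01 wphi wdphi Dle).
Qed.
End bayes_minimax.

Lemma integrable_inv_mul (R : realType) (h : R -> R) :
  (forall k, 0 < k <= 1 -> 0 < h k) -> continuously_differentiable_in `]0, 1] h ->
  (\int[@lebesgue_measure R]_(k in `]0%R, 1%R[) (k^-1 * h k)%:E < +oo)%E ->
  (@lebesgue_measure R).-integrable `]0, 1[ (fun k => (k^-1 * h k)%:E).
Proof.
move=> h_gt0 h_C1 hfin; apply/integrableP; split.
  apply/measurable_EFinP; apply: measurable_continuous01 => k k01.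
  have /andP[k0 _] := k01; apply: cvgM.
    by apply: cvgV; [rewrite gt_eqF|exact: cvg_id].
  exact: drv_continuous (is_derive_derive_in h_C1 k01).
apply: le_lt_trans hfin; rewrite le_eqVlt; apply/orP; left; apply/eqP.
apply: eq_integral => k /set_mem/=.
rewrite in_itv/= => /andP[k0 k1].
by rewrite ger0_norm// mulr_ge0 ?invr_ge0 ?ltW// h_gt0// k0 ltW.
Qed.

Unset Implicit Arguments.

Theorem corollary3p1 (R : realType) (p : nat) (a b : R) (h : R -> R)
  (p_gt0 : (0 < p)%N)
  (a_lt1 : a < 1) (b_gt0 : 0 < b) (b_lt1 : b < 1)
  (h_gt0 : forall k, 0 < k <= 1 -> 0 < h k)
  (h_C1 : continuously_differentiable_in `]0, 1] h)
  (h_slow : slowly_varying0 h)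
  (h_lim : k * derive_in `]0, 1] h k / h k @[k --> 0^'+] --> (0 : R))
  (a_cond : - (p%:R / 2) < a \/
    a = - (p%:R / 2) /\
    (\int[@lebesgue_measure R]_(k in `]0%R, 1%R[) (k^-1 * h k)%:E < +oo)%E)
  (a_lb : - (p%:R / 2) <= a) (a_ub : a < p%:R / 2 - 2) :
  ({in `[0, 1] &, {homo log_slope h : x y /~ x <= y}} ->
   - (p%:R / 2 + a + 2) <= log_slope h 1 ->
   (p%:R + 2 * a + 2) / (3 * p%:R / 2 + a) <= b ->
   minimax (@bayes_estimator R p (prior a b h)))
  /\
  ({in `[0, 1] &, {homo log_slope h : x y / x <= y}} ->
   log_slope h 1 < (p%:R / 2 - a - 2) / 2 ->
   (p%:R + 2 * a + 2 + 2 * log_slope h 1) / (3 * p%:R / 2 + a) <= b ->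
   minimax (@bayes_estimator R p (prior a b h))).
Proof.
have p0 : 0 < p%:R :> R by rewrite ltr0n.
have c0 : 0 <= p%:R / 2 + a by lra.
have d0 : 0 < 3 * p%:R / 2 + a by lra.
have h_int : p%:R / 2 + a = 0 ->
    (@lebesgue_measure R).-integrable `]0, 1[ (fun k => (k^-1 * h k)%:E).
  move=> c00; case: a_cond => [|[_]]; first by lra.
  exact: integrable_inv_mul.
have lsE (k : R) : 0 < k -> log_slope h k = k * derive_in `]0, 1] h k / h k.
  by move=> k0; rewrite /log_slope gt_eqF.
have ls0 : log_slope h 0 = 0 by rewrite /log_slope eqxx.
have h0 (k : R) : 0 < k < 1 -> 0 < h k by move=> /andP[k0 k1]; rewrite h_gt0// k0 ltW.
have dh := is_derive_derive_in h_C1.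
have chp := continuous_derive_in h_C1.
have h_at1 : exists h1 : R, h k @[k --> (1 : R)^'-] --> h1 by exists (h 1); exact: cvg_left1.
split=> mono H1 hb.
- have Hmon (k l : R) : 0 <= k -> k <= l -> l <= 1 -> log_slope h l <= log_slope h k.
    by move=> k0 kl l1; apply: mono; rewrite ?in_itv/=; lra.
  (* H(0) = 0 and monotonicity fix the sign of H; the value at 1 then bounds |H|. *)
  have H0 (k : R) : 0 < k < 1 -> k * derive_in `]0, 1] h k / h k <= 0.
    by move=> /andP[k0 k1]; rewrite -lsE// -ls0; apply: Hmon; lra.
  have HB (k : R) : 0 < k < 1 -> `|k * derive_in `]0, 1] h k / h k| <= - log_slope h 1.
    move=> /[dup] /H0 Hk /andP[k0 k1]; rewrite ler0_norm// lerN2 -lsE//.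
    by apply: Hmon; lra.
  have h_at0 := powR_mul_cvg0 h_gt0 h_C1 h_lim HB.
  have intu := integrable_prior_weight h_gt0 h_C1 h_lim HB c0 b_gt0 b_lt1 h_int.
  have cpos : 0 < p%:R / 2 + a.
    rewrite lt_neqAle c0 andbT; apply/eqP => /esym/h_int ih.
    exact: (integrable_inv_nonincreasing_false h_gt0 h_C1 ih H0).
  apply: (bayes_estimator_minimax p_gt0 c0 b_gt0 b_lt1 h_gt0 h_C1 h_lim h_int HB) => v v0.
  apply: (dominance_nonincreasing c0 b_gt0 b_lt1 h0 dh chp HB h_at0 h_at1 intu v0 H0) => //.
  + move=> k l k0 kl l1; rewrite -!lsE//; last exact: lt_le_trans kl.
    by apply: Hmon => //; exact: ltW.
  + lra.
  (* With c = p/2 + a, the numerator is 2 (c + 1) and the denominator p + c. *)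
  + by move: hb; rewrite ler_pdivrMr//; lra.
- have Hmon (k l : R) : 0 <= k -> k <= l -> l <= 1 -> log_slope h k <= log_slope h l.
    by move=> k0 kl l1; apply: mono; rewrite ?in_itv/=; lra.
  have HH (k : R) : 0 < k < 1 -> 0 <= k * derive_in `]0, 1] h k / h k <= log_slope h 1.
    move=> /andP[k0 k1]; rewrite -lsE// -{1}ls0; apply/andP; split; apply: Hmon; lra.
  have HB (k : R) : 0 < k < 1 -> `|k * derive_in `]0, 1] h k / h k| <= log_slope h 1.
    by move=> /HH/andP[Hk Hk1]; rewrite ger0_norm.
  have h_at0 := powR_mul_cvg0 h_gt0 h_C1 h_lim HB.
  have intu := integrable_prior_weight h_gt0 h_C1 h_lim HB c0 b_gt0 b_lt1 h_int.
  apply: (bayes_estimator_minimax p_gt0 c0 b_gt0 b_lt1 h_gt0 h_C1 h_lim h_int HB) => v v0.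
  apply: (dominance_nondecreasing c0 b_gt0 b_lt1 h0 dh chp HB h_at0 h_at1 intu v0 HH).
  + lra.
  + by move: hb; rewrite ler_pdivrMr//; lra.
Qed.
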